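(* For a positive integer $k$ and $n\ge 2$, assign to the edges $e$ of the complete graph $K_n$ independent random weights $X_e$, each uniformly distributed on $[0,1]$, and let $\mathrm{mst}_k(K_n)$ denote the expected value of the minimum total weight of $k$ edge-disjoint spanning trees of $K_n$. Let $\mu_k^*=\liminf_{n\to\infty}\mathrm{mst}_k(K_n)$ and $\mu_k^{**}=\limsup_{n\to\infty}\mathrm{mst}_k(K_n)$. Then $$\lim_{k\to\infty}\frac{\mu_k^*}{k^2}=\lim_{k\to\infty}\frac{\mu_k^{**}}{k^2}=1.$$ *)

(* Defs.v *)
From HB Require Import structures.
From mathcomp Require Import all_boot all_order all_algebra.
From mathcomp Require Import all_classical all_reals all_analysis.

Set Implicit Arguments.
Unset Strict Implicit.
Unset Printing Implicit Defensive.

Import Order.TTheory GRing.Theory Num.Theory.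
Import numFieldNormedType.Exports.

Local Open Scope classical_set_scope.
Local Open Scope ring_scope.

(* The edges of the complete graph on the vertex set 'I_n. *)
Definition edge (n : nat) := {e : {set 'I_n} | #|e| == 2%N}.

Definition adjacent (n : nat) (F : {set edge n}) : rel 'I_n :=
  fun u v => [exists e in F, val e == [set u; v]%SET].

Definition connected_graph (n : nat) (F : {set edge n}) : Prop :=
  forall u v : 'I_n, connect (adjacent F) u v.

(* A duplicate-free closed walk of size 2 runs back and forth along a single
   edge; the graph cycles are those of size at least 3. *)
Definition acyclic_graph (n : nat) (F : {set edge n}) : Prop :=
  forall c : seq 'I_n, ucycle (adjacent F) c -> (size c < 3)%N.

Definition spanning_tree (n : nat) (F : {set edge n}) : Prop :=
  connected_graph F /\ acyclic_graph F.

Definition disjoint_spanning_trees (k n : nat)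
    (F : {ffun 'I_k -> {set edge n}}) : Prop :=
  (forall i, spanning_tree (F i)) /\
  (forall i j, i != j -> (F i :&: F j)%SET = finset.set0).

(* The value is +oo when there are no k edge-disjoint spanning trees, which
   for k >= 1 and n >= 2 happens exactly when n < 2 * k. *)
Definition min_weight (R : realType) (k n : nat) (x : edge n -> R) : \bar R :=
  \big[mine/+oo%E]_(F : {ffun 'I_k -> {set edge n}}
                      | `[< disjoint_spanning_trees F >])
    (\sum_(i < k) \sum_(e in F i) x e)%:E.

Section Weights.
Context {R : realType} {d : measure_display} {T : measurableType d}.
Variable P : probability T R.

Definition uniform01 (X : {RV P >-> R}) : Prop :=
  forall A : set R, measurable A ->
    distribution P X A = uniform_prob (@ltr01 R) A.

Definition mutually_independent (I : finType) (X : I -> {RV P >-> R}) : Prop :=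
  forall (J : {set I}) (A : I -> set R), (forall i, measurable (A i)) ->
    P [set w | forall i, i \in J -> A i (X i w)] =
    (\prod_(i in J) P (X i @^-1` A i))%E.

(* An extended-real integral, because of the value +oo of [min_weight]. *)
Definition mst (k n : nat) (X : edge n -> {RV P >-> R}) : \bar R :=
  (\int[P]_w min_weight k (fun e => X e w))%E.

End Weights.

(* Main.v *)
Require Import Defs.
From HB Require Import structures.
From mathcomp Require Import all_boot all_order all_algebra.
From mathcomp Require Import all_classical all_reals all_analysis.
From mathcomp Require Import measurable_realfun zify ring lra.

Set Implicit Arguments.
Unset Strict Implicit.
Unset Printing Implicit Defensive.

Import Order.TTheory GRing.Theory Num.Theory.
Import numFieldNormedType.Exports.

Local Open Scope classical_set_scope.
Local Open Scope ring_scope.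

(** Replace each weight by its cell ]j/n, (j+1)/n]: the cell indices are
    independent and uniform, so both bounds are averages over a finite product.

    Lower bound: k disjoint spanning trees have k(n-1) edges, and for c = 2k the
    weight of N edges is at least (c N - \sum_e (c - level e)) / n, where the
    truncated differences are summed over all the edges of the graph.

    Upper bound: every colouring of the edges yields an upper bound, so one may
    average over random colourings. A small fraction of the edges is reserved, one
    colour for each tree; the other edges are oriented at random. The vertices
    fall into m blocks, and the k trees are spread evenly over the blocks. For
    each block, a vertex outside it assigns its light out-edges into the block to
    distinct trees of that block; this is automatically acyclic and costs about
    k^2, and by Chebyshev all but a small fraction of the wanted edges exist.
    Tree i is completed by reserved edges of colour i with levels t, 2t, 4t, ...;
    the number of edges used between levels T and 2T is at most the number of
    components of the reserved graph below level T. Its expected excess over 1 is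
    O(1/(n q^2)) for a random graph of density q, because a vertex is joined to
    a smaller one by a path of length at most 2 except with small probability;
    the decay in q makes the sum over the dyadic levels converge. *)

Local Notation adjacent := Defs.adjacent.

(** * Components and spanning trees *)

Section Graphs.
Local Open Scope nat_scope.
Local Open Scope set_scope.
Variable n : nat.
Implicit Types (F G A B D : {set edge n}) (u v w : 'I_n) (e : edge n).

Notation joined F := (connect (adjacent F)).

Lemma adjacent_sym F : symmetric (adjacent F).
Proof.
by move=> u v; apply: eq_existsb => e; rewrite finset.setUC.
Qed.

Lemma joined_sym F u v : joined F u v = joined F v u.
Proof. exact: (sym_connect_sym (@adjacent_sym F)). Qed.

Lemma adjacent_mem F e u v : e \in F -> val e = [set u; v] -> adjacent F u v.
Proof. by move=> eF ev; apply/existsP; exists e; rewrite eF ev eqxx. Qed.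

Lemma edge_ends e : exists u v, u != v /\ val e = [set u; v].
Proof. by have /cards2P[u [v [uv ev]]] := valP e; exists u, v. Qed.

Lemma joined_mono F G : F \subset G -> subrel (joined F) (joined G).
Proof.
move=> FG; apply: connect_sub => u v /existsP[e /andP[eF ev]].
by apply/connect1/existsP; exists e; rewrite (fintype.subsetP FG).
Qed.

Definition spans F B := forall e u v, e \in B -> val e = [set u; v] -> joined F u v.

Lemma spans_joined F B : spans F B -> subrel (joined B) (joined F).
Proof.
move=> FB; apply: connect_sub => u v /existsP[e /andP[eB /eqP ev]].
exact: FB ev.
Qed.

(* The nonzero minima of the components: one fewer than the components. *)
Definition roots F : {set 'I_n} :=
  [set v : 'I_n | (0 < v) && [forall (u : 'I_n | u < v), ~~ joined F u v]].

Lemma rootsP F v :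
  reflect (0 < v /\ forall u, joined F u v -> v <= u) (v \in roots F).
Proof.
rewrite inE; apply: (iffP andP) => -[-> H]; split=> //.
  by move=> u uv; rewrite leqNgt; apply/negP => /(forall_inP H); rewrite uv.
by apply/forall_inP => u; rewrite ltnNge; apply/contra/H.
Qed.

Lemma roots_antimono F G :
  subrel (joined F) (joined G) -> roots G \subset roots F.
Proof.
move=> FG; apply/fintype.subsetP => v /rootsP[v0 Gv]; apply/rootsP; split=> // u /FG.
exact: Gv.
Qed.

Lemma component_min F v :
  exists2 u, joined F u v & forall w, joined F w v -> u <= w.
Proof.
by case: (@arg_minnP _ v (fun u => joined F u v) val (connect0 _ _)) => u; exists u.
Qed.

Lemma roots_eq0 F : roots F = finset.set0 -> connected_graph F.
Proof.
move=> F0 u v.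
have zero w : exists2 z : 'I_n, joined F z w & z = 0 :> nat.
  have [z zw zmin] := component_min F w; exists z => //.
  have : z \notin roots F by rewrite F0 inE.
  apply: contraNeq; rewrite -lt0n => z0; apply/rootsP; split=> // t tz.
  exact/zmin/(connect_trans tz).
have [y yu y0] := zero u; have [z zv z0] := zero v.
have yz : y = z by apply/val_inj; rewrite /= y0.
by rewrite -yz in zv; apply: connect_trans zv; rewrite joined_sym.
Qed.

(** Of the minima of the two merged components, the larger one stops being a minimum, and no new
    root appears. By symmetry in [u] and [v], the lost root may be taken to be the minimum [z] on
    the side of [v]. *)
Lemma card_roots_setU1 F e u v : val e = [set u; v] -> ~~ joined F u v ->
  #|roots (e |: F)| < #|roots F|.
Proof.
wlog suff: u v / forall y z, joined F y u -> (forall w, joined F w u -> y <= w) ->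
    joined F z v -> (forall w, joined F w v -> z <= w) -> y < z ->
    val e = [set u; v] -> ~~ joined F u v -> #|roots (e |: F)| < #|roots F|.
  move=> H ev uv; have [y yu ymin] := component_min F u.
  have [z zv zmin] := component_min F v.
  have [yz|zy|/val_inj yz] := ltngtP y z.
  - exact: (H u v y z).
  - by apply: (H v u z y) => //; rewrite 1?finset.setUC // joined_sym.
  - case/negP: uv; rewrite yz joined_sym in yu.
    exact: connect_trans zv.
move=> y z yu _ zv zmin yz ev uv; apply/proper_card/properP; split.
  by apply/roots_antimono/joined_mono/finset.subsetUr.
exists z; first apply/rootsP.
  split=> [|t tz]; first exact: leq_trans yz.
  exact/zmin/(connect_trans tz).
apply/negP => /rootsP[_ /(_ y) H].
suff /H : joined (e |: F) y z by rewrite leqNgt yz.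
have FeF := @joined_mono F (e |: F) (finset.subsetUr _ _).
apply: connect_trans (FeF _ _ yu) _.
apply: (@connect_trans _ _ v); last by rewrite joined_sym; apply: FeF.
by apply: connect1; apply: (@adjacent_mem _ e) => //; rewrite finset.setU11.
Qed.

(** Greedy insertion, as in Kruskal's algorithm: an edge of [B] is added only when its ends are not
    yet joined, so that each added edge is paid for by a root that disappears. *)
Lemma extend_to_span A B : exists A', [/\ A' \subset B,
  #|A'| + #|roots (A :|: A')| <= #|roots A| & spans (A :|: A') B].
Proof.
suff /(_ (enum B)) [A' [sA' cA' AB]] : forall s : seq (edge n), exists A',
    [/\ {subset A' <= s}, #|A'| + #|roots (A :|: A')| <= #|roots A| &
      forall e u v, e \in s -> val e = [set u; v] -> joined (A :|: A') u v].
  exists A'; split=> //; first by apply/fintype.subsetP => e /sA'; rewrite mem_enum.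
  by move=> e u v eB; apply: AB; rewrite mem_enum.
elim=> [|e s [A' [sA' cA' AB]]].
  by exists finset.set0; split=> // [e|]; rewrite ?inE // cards0 finset.setU0.
have [u [v [_ ev]]] := edge_ends e.
have pair_inj a b : val e = [set a; b] -> (a = u /\ b = v) \/ (a = v /\ b = u).
  rewrite ev => uvab; have := finset.set21 a b; have := finset.set22 a b.
  rewrite -uvab => /set2P[] bE /set2P[] aE; auto.
    by have := finset.set22 u v; rewrite uvab aE bE => /set2P[]; auto.
  by have := finset.set21 u v; rewrite uvab aE bE => /set2P[]; auto.
have [uv|uv] := boolP (joined (A :|: A') u v).
  exists A'; split=> // [f /sA' fs|f a b]; rewrite inE; first by rewrite fs orbT.
  case/predU1P=> [->|]; last exact: AB.
  by move=> /pair_inj [][-> ->] //; rewrite joined_sym.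
have UE : A :|: (e |: A') = e |: (A :|: A') by rewrite finset.setUCA.
exists (e |: A'); split; rewrite ?UE.
- by move=> f; rewrite !inE => /predU1P[->|/sA' ->]; rewrite ?eqxx ?orbT.
- rewrite cardsU1 -addnA addnCA; apply: leq_trans cA'; rewrite leq_add2l.
  by apply: leq_trans (card_roots_setU1 ev uv); case: (e \notin A').
- have mono := @joined_mono (A :|: A') (e |: (A :|: A')) (finset.subsetUr _ _).
  move=> f a b; rewrite inE => /predU1P[->|fs fab]; last exact/mono/(AB f).
  have uve : joined (e |: (A :|: A')) u v.
    by apply/connect1/(@adjacent_mem _ e) => //; rewrite finset.setU11.
  by move=> /pair_inj [][-> ->] //; rewrite joined_sym.
Qed.

(** Sending each element of [M] to a member of [S] in its component is injective, because a
    component has only one minimum. *)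
Lemma card_minima_cover F (M S : {set 'I_n}) :
  (forall v, v \in M -> forall u, joined F u v -> v <= u) ->
  (forall v, exists2 s, s \in S & joined F v s) -> #|M| <= #|S|.
Proof.
move=> minM cover; pose f v := odflt v [pick s in S | joined F v s].
have fP v : f v \in S /\ joined F v (f v).
  rewrite /f; case: pickP => [s /andP[]//|/= none].
  by have [s sS vs] := cover v; move: (none s); rewrite sS vs.
rewrite -(card_in_imset (f := f)).
  by apply/subset_leq_card/fintype.subsetP => _ /imsetP[v _ ->]; case: (fP v).
move=> u v uM vM fuv; have uv : joined F u v.
  by apply: connect_trans (fP u).2 _; rewrite fuv joined_sym (fP v).2.
by apply/val_inj/eqP; rewrite eqn_leq (minM u uM) 1?joined_sym // (minM v vM).
Qed.

Lemma card_roots_cover F (S : {set 'I_n}) :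
  (forall v, exists2 s, s \in S & joined F v s) -> #|roots F| <= #|S|.
Proof. by apply: card_minima_cover => v /rootsP[]. Qed.

(** The vertex 0 is a component minimum that is never a root; adjoining it to the roots gives the
    strict inequality. *)
Lemma card_roots_cover_lt F (S : {set 'I_n}) : 0 < n ->
  (forall v, exists2 s, s \in S & joined F v s) -> #|roots F| < #|S|.
Proof.
move=> n0 cover; pose o : 'I_n := Ordinal n0.
have -> : #|roots F|.+1 = #|o |: roots F| by rewrite cardsU1 inE.
apply: (@card_minima_cover F) cover => v; rewrite finset.in_setU1.
by case/predU1P=> [-> //|/rootsP[]].
Qed.

(** An inclusion-minimal connected subgraph has no cycle: an edge of a cycle could be deleted, since
    the rest of the cycle still joins its ends. *)
Lemma connected_spanning_tree D : connected_graph D ->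
  exists2 F : {set edge n}, F \subset D & spanning_tree F.
Proof.
move=> connD.
pose cg F := [forall u, forall v, joined F u v].
have cgP F : reflect (connected_graph F) (cg F).
  by apply: (iffP forallP) => H u; [exact/forallP|apply/forallP].
have [F /minsetP[/cgP connF minF] FD] := minset_exists (introT (cgP D) connD).
exists F => //; split=> // c /andP[cyc uc]; rewrite ltnNge; apply/negP => c3.
case: c c3 cyc uc => [|x [|y [|z p]]] //= _ /and3P[xy yz zp].
rewrite !inE !negb_or => /and4P[/and3P[xNy xNz xNp] /andP[yNz yNp] zNp up].
have [e /andP[eF /eqP exy]] := existsP xy.
suff H : cg (F :\ e).
  have /finset.setP/(_ e) := minF _ H (finset.subD1set F e).
  by rewrite !inE eqxx eF.
have keep a b : adjacent F a b -> [set a; b] != [set x; y] ->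
    adjacent (F :\ e) a b.
  move=> /existsP[f /andP[fF /eqP fab]] abxy; apply/existsP; exists f.
  rewrite !inE fF fab eqxx !andbT; apply: contraNneq abxy => fe.
  by rewrite -fab fe exy.
(* The cycle is [x, y, z, p]. The walk from [y] through [z] and [p] back to [x] avoids the edge
   [xy], because the vertices of the cycle are distinct. *)
have yx : joined (F :\ e) y x.
  apply: (@connect_trans _ _ z).
    apply/connect1/keep => //; apply/negP => /eqP/finset.setP/(_ x).
    by rewrite !inE eqxx (negPf xNy) (negPf xNz).
  have : path (adjacent (F :\ e)) z (rcons p x).
    move: zp; rewrite !rcons_path => /andP[zp lx]; apply/andP; split.
      elim: p z zp {yz xNz yNz zNp lx up} xNp yNp => //= a p IH z /andP[za ap].
      rewrite !inE !negb_or => /andP[xNa xNp] /andP[yNa yNp].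
      rewrite IH // andbT keep //; apply/negP => /eqP/finset.setP/(_ a).
      by rewrite !inE eqxx orbT !(eq_sym a) (negPf xNa) (negPf yNa).
    apply: keep => //; apply/negP => /eqP/finset.setP/(_ y).
    rewrite !inE eqxx orbT (eq_sym y x) (negPf xNy) orbF => /eqP ly.
    have : last z p \in z :: p by exact: mem_last.
    by rewrite -ly inE (negPf yNz) (negPf yNp).
  by move=> pth; apply/connectP; exists (rcons p x); rewrite ?last_rcons.
have span : spans (F :\ e) F.
  move=> f a b fF fab; have [fe|fNe] := eqVneq f e; last first.
    by apply/connect1/(@adjacent_mem _ f) => //; rewrite !inE fNe.
  have := finset.set21 a b; have := finset.set22 a b; rewrite -fab fe exy !inE.
  by move=> /orP[]/eqP-> /orP[]/eqP->; rewrite ?connect0 // joined_sym.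
by apply/cgP => u v; apply: (spans_joined span).
Qed.

End Graphs.

(** * Cost of completing a forest to a spanning tree, and edge counts *)

Section Cost.
Local Open Scope nat_scope.
Local Open Scope set_scope.
Variable n : nat.
Implicit Types (F G A B D : {set edge n}) (u v w : 'I_n) (e : edge n).

Notation joined F := (connect (adjacent F)).

(** Stage [j] adds greedily edges of [B] of level below [t * 2 ^ j]. Stage 0 adds at most one edge
    per root of [A]. After stage [j] the current set spans the edges of that stage, so stage [j.+1]
    adds at most as many edges as they leave roots. After stage [J] the graph is connected, and
    passing to a spanning tree only lowers the cost. *)
Lemma spanning_tree_completion A B (lev : edge n -> nat) (t J : nat) :
  (forall e, e \in B -> lev e < t * 2 ^ J) -> roots B = finset.set0 ->
  exists D : {set edge n}, [/\ spanning_tree D, D \subset A :|: B &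
    \sum_(e in D) (lev e).+1 <= \sum_(e in A) (lev e).+1 + t * #|roots A| +
      \sum_(j < J) t * 2 ^ j.+1 * #|roots [set e in B | lev e < t * 2 ^ j]|].
Proof.
move=> levB B0; pose Bj j := [set e in B | lev e < t * 2 ^ j].
have BjB j : Bj j \subset B by apply/fintype.subsetP => e; rewrite inE => /andP[].
have cost j (A' C : {set edge n}) m : A' \subset Bj j -> #|A'| <= m ->
    \sum_(e in C :|: A') (lev e).+1 <= \sum_(e in C) (lev e).+1 + t * 2 ^ j * m.
  move=> A'B A'm; rewrite (bigID (mem C)) /=; apply: leq_add.
    rewrite leq_eqVlt; apply/orP; left; apply/eqP/eq_bigl => e.
    by rewrite !inE andbC; case: (e \in C).
  apply: leq_trans (_ : t * 2 ^ j * #|A'| <= _); last by rewrite leq_mul.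
  rewrite mulnC -sum_nat_const big_mkcond [leqRHS]big_mkcond; apply: leq_sum => e _.
  rewrite !inE; case: (e \in C) => //=.
  by rewrite andbT; case: ifP => // /(fintype.subsetP A'B); rewrite inE => /andP[].
suff [D [DAB DB costD]] : exists D : {set edge n}, [/\ D \subset A :|: B, spans D (Bj J) &
    \sum_(e in D) (lev e).+1 <= \sum_(e in A) (lev e).+1 + t * #|roots A| +
      \sum_(j < J) t * 2 ^ j.+1 * #|roots (Bj j)|].
  have BJ : Bj J = B.
    apply/finset.setP => e; rewrite inE; case eB: (e \in B) => //=; exact: levB.
  have conn : connected_graph D.
    apply: roots_eq0; apply/eqP; rewrite -finset.subset0 -B0; apply: roots_antimono.
    by rewrite -{1}BJ; apply: spans_joined.
  have [E ED treeE] := connected_spanning_tree conn.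
  exists E; split=> //; first exact: fintype.subset_trans DAB.
  by apply: leq_trans costD; rewrite [leqRHS](big_setID E) /= (finset.setIidPr ED) leq_addr.
elim: {levB} J => [|J [C [CAB CB costC]]].
  have [A' [A'B card AA']] := extend_to_span A (Bj 0).
  exists (A :|: A'); split=> //.
    by rewrite finset.setUS // (fintype.subset_trans A'B).
  rewrite big_ord0 addn0 -{1}[t](muln1 t).
  by apply: cost A'B _; apply: leq_trans card; rewrite leq_addr.
have [A' [A'B card AA']] := extend_to_span C (Bj J.+1).
exists (C :|: A'); split=> //.
  by rewrite finset.subUset CAB (fintype.subset_trans A'B) // finset.subsetU // BjB orbT.
rewrite big_ord_recr /= addnA; apply: leq_trans (cost J.+1 A' C #|roots (Bj J)| A'B _) _.
  apply: leq_trans (leq_addr _ _) (leq_trans card _).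
  by apply/subset_leq_card/roots_antimono/spans_joined.
by rewrite leq_add2r.
Qed.

(** The walk is followed up to its first use of [e], which starts at [a] or at [b]. *)
Lemma joined_setU1 F e a b u v : val e = [set a; b] -> joined (e |: F) u v ->
  [|| joined F u v, joined F u a | joined F u b].
Proof.
move=> eab /connectP[p]; elim: p u => [|w p IH] u /=; first by move=> _ ->; rewrite connect0.
case/andP=> /existsP[f]; rewrite in_setU1 => /andP[/orP[/eqP->|fF] /eqP fuw] wp vE.
  have: u \in [set a; b] by rewrite -eab fuw finset.set21.
  by move=> /set2P[]->; rewrite connect0 ?orbT.
have uw := connect1 (adjacent_mem fF fuw).
by case/or3P: (IH w wp vE) => /(connect_trans uw) ->; rewrite ?orbT.
Qed.

(** The minima of the components of [e |: F], vertex 0 included, together with one end of [e], meet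
    every component of [F]. *)
Lemma card_roots_setU1_ge F e : #|roots F| <= #|roots (e |: F)|.+1.
Proof.
have [a [b [_ eab]]] := edge_ends e.
have n0 : 0 < n by apply: leq_trans (ltn_ord a).
pose o : 'I_n := Ordinal n0; pose S := o |: roots (e |: F).
have minS v : exists2 z, z \in S & joined (e |: F) v z.
  have [z zv zmin] := component_min (e |: F) v; exists z; last by rewrite joined_sym.
  rewrite !inE; have [z0|z0] := posnP z.
    by rewrite -val_eqE /= z0 eqxx.
  apply/orP; right; apply/andP; split=> //; apply/forall_inP => u uz.
  apply/negP => /connect_trans /(_ zv) /zmin; by rewrite leqNgt uz.
have FF := @joined_mono _ F (e |: F) (finset.subsetUr _ _).
(* The component of [e] has a minimum [z], and without the help of [e] this [z] is still joined to
   one of the two ends, which is renamed [a]. *)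
wlog [z zS az] : a b eab / exists2 z, z \in S & joined F a z.
  move=> H; have [z zS az] := minS a.
  have ba : joined (e |: F) a b.
    by apply/connect1/(@adjacent_mem _ _ e) => //; rewrite finset.setU11.
  have := joined_setU1 eab; rewrite joined_sym in az.
  move=> /(_ F z a az) /or3P[] h; rewrite joined_sym in h.
  - by apply: (H a b eab); exists z.
  - by apply: (H a b eab); exists z.
  - by apply: (H b a); [rewrite finset.setUC|exists z].
suff : #|roots F| < #|b |: S|.
  move=> h; rewrite -ltnS; apply: leq_trans h _.
  rewrite /S !cardsU1.
  exact: leq_add (leq_b1 _) (leq_add (leq_b1 _) (leqnn _)).
apply: card_roots_cover_lt => // v; have [y yS vy] := minS v.
case/or3P: (joined_setU1 eab vy) => h.
- by exists y => //; rewrite inE yS orbT.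
- by exists z; [rewrite inE zS orbT|apply: connect_trans az].
- by exists b => //; rewrite finset.setU11.
Qed.

(** The empty graph has [n.-1] roots, a connected one has none, and each inserted edge removes at
    most one. *)
Lemma connected_card F : connected_graph F -> n.-1 <= #|F|.
Proof.
case: (posnP n) => [n00 _|n0 conn].
  by apply: (@leq_trans 0); rewrite // leqn0 -subn1 subn_eq0 n00.
pose o : 'I_n := Ordinal n0.
have F0 : roots F = finset.set0.
  apply/finset.setP => v; rewrite finset.in_set0; apply/negbTE/negP => /rootsP[v0].
  by move=> /(_ o (conn o v)); rewrite leqNgt v0.
suff : forall s : seq (edge n), n.-1 <= size s + #|roots [set e in s]|.
  move=> /(_ (enum F)); rewrite -cardE.
  have -> : [set e in enum F] = F by apply/finset.setP => e; rewrite inE mem_enum.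
  by rewrite F0 cards0 addn0.
elim=> [|e s IH] /=.
  rewrite add0n -{1}(card_ord n) -(cardsT 'I_n) (cardsD1 o) finset.in_setT /=.
  apply/subset_leq_card/fintype.subsetP => v; rewrite finset.in_setD1.
  rewrite finset.in_setT andbT => vo.
  apply/rootsP; split; first by rewrite lt0n.
  move=> u /connectP[[|w p] /= ]; first by move=> _ ->.
  by case/andP=> /existsP[e]; rewrite !inE.
apply: leq_trans IH _; rewrite addSnnS leq_add2l.
have -> : [set f in e :: s] = e |: [set f in s].
  by apply/finset.setP => f; rewrite !inE.
exact: card_roots_setU1_ge.
Qed.

(** Every edge satisfies [c <= lev e + (c - lev e)] with truncated subtraction. Summed over the at
    least [k * n.-1] tree edges, the truncated differences occur at most once per edge of the graph
    because the trees are disjoint. *)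
Lemma disjoint_trees_level_sum (k c : nat) (F : {ffun 'I_k -> {set edge n}})
    (lev : edge n -> nat) : disjoint_spanning_trees F ->
  c * (k * n.-1) <= \sum_(i < k) \sum_(e in F i) lev e + \sum_e (c - lev e).
Proof.
case=> treeF disjF.
have cov : \sum_(i < k) \sum_(e in F i) (c - lev e) <= \sum_e (c - lev e).
  have part e : \sum_(i < k | e \in F i) (c - lev e) <= c - lev e.
    case: (pickP (fun i => e \in F i)) => [i eFi|none]; last by rewrite big_pred0.
    rewrite (bigD1 i) //= big_pred0 ?addn0 // => j; apply/negbTE/negP => /andP[eFj ji].
    by have /finset.setP/(_ e) := disjF j i ji; rewrite !inE eFj eFi.
  rewrite (exchange_big_dep xpredT) //=; exact: leq_sum.
apply: leq_trans (leq_add (leqnn _) cov); rewrite -big_split /=.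
rewrite mulnCA -[k in k * _]card_ord -sum_nat_const; apply: leq_sum => i _.
rewrite -big_split /= mulnC.
apply: leq_trans (_ : #|F i| * c <= _).
  by rewrite leq_mul2r connected_card ?orbT //; case: (treeF i).
by rewrite -sum_nat_const; apply: leq_sum => e _; rewrite -leq_subLR.
Qed.

End Cost.

(** * Deterministic bounds on the minimum weight *)

Section MinWeight.
Variables (R : realType) (n k : nat).
Implicit Types (x : edge n -> R) (lev : edge n -> nat).

Lemma min_weight_le (F : {ffun 'I_k -> {set edge n}}) x :
  disjoint_spanning_trees F ->
  (min_weight k x <= (\sum_(i < k) \sum_(e in F i) x e)%:E)%E.
Proof. by move=> FP; apply: bigmin_le_cond; apply/asboolP. Qed.

(* In units of the cell length 1/M; the term of j pays t * 2 ^ j.+1 for each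
   component left by the reserved edges of level below t * 2 ^ j. *)
Definition completion_cost (H B : 'I_k -> {set edge n}) lev (t J : nat) : nat :=
  (\sum_(i < k) (\sum_(e in H i) (lev e).+1 + t * #|roots (H i)| +
    \sum_(j < J) t * 2 ^ j.+1 * #|roots [set e in B i | lev e < t * 2 ^ j]|))%N.

(** Each [H i] is completed inside [H i :|: B i], so disjointness is inherited by the trees. The
    successor of the level stands for the right end of the cell. *)
Lemma min_weight_le_completion (H B : 'I_k -> {set edge n}) lev (t J M : nat) x :
  (forall i j, i != j -> ((H i :|: B i) :&: (H j :|: B j))%SET = finset.set0) ->
  (forall i e, e \in B i -> (lev e < t * 2 ^ J)%N) ->
  (forall i, roots (B i) = finset.set0) ->
  (forall e, x e <= (lev e).+1%:R / M%:R) ->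
  (min_weight k x <= ((completion_cost H B lev t J)%:R / M%:R)%:E)%E.
Proof.
move=> disj levB B0 xlev.
have /fin_all_exists [D DP] i := spanning_tree_completion (H i) (levB i) (B0 i).
have treeD : disjoint_spanning_trees [ffun i => D i].
  split=> [i|i j ij]; rewrite ?ffunE; first by case: (DP i).
  apply/eqP; rewrite -finset.subset0 -(disj i j ij) finset.setISS //.
    by case: (DP i).
  by case: (DP j).
apply: le_trans (min_weight_le _ treeD) _.
rewrite lee_fin /completion_cost natr_sum mulr_suml; apply: ler_sum => i _.
rewrite ffunE; case: (DP i) => _ _ costD.
apply: le_trans (_ : (\sum_(e in D i) (lev e).+1)%N%:R / M%:R <= _).
  by rewrite natr_sum mulr_suml; apply: ler_sum => e _.
by rewrite ler_wpM2r ?invr_ge0 // ler_nat.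
Qed.

Lemma disjoint_spanning_trees_exist (B : 'I_k -> {set edge n}) :
  (forall i j, i != j -> (B i :&: B j)%SET = finset.set0) ->
  (forall i, roots (B i) = finset.set0) ->
  exists F : {ffun 'I_k -> {set edge n}}, disjoint_spanning_trees F.
Proof.
move=> disj B0.
have /fin_all_exists2 [D DB DT] i := connected_spanning_tree (roots_eq0 (B0 i)).
exists [ffun i => D i]; split=> [i|i j ij]; rewrite !ffunE //.
by apply/eqP; rewrite -finset.subset0 -(disj i j ij) finset.setISS.
Qed.

(** A crude bound, to be spent on the rare outcomes in which some reserve is disconnected. *)
Lemma min_weight_le_card (F : {ffun 'I_k -> {set edge n}}) x :
  disjoint_spanning_trees F -> (forall e, 0 <= x e <= 1) ->
  (min_weight k x <= (k * #|{: edge n}|)%:R%:E)%E.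
Proof.
move=> FP x01; apply: le_trans (min_weight_le _ FP) _; rewrite lee_fin natrM.
rewrite -[k in k%:R]card_ord mulr_natl -sumr_const; apply: ler_sum => i _.
apply: le_trans (_ : \sum_(e in F i) 1 <= _).
  by apply: ler_sum => e _; case/andP: (x01 e).
by rewrite sumr_const ler_nat max_card.
Qed.

Lemma min_weight_ge (c M : nat) lev x : (0 < M)%N ->
  (forall e, (lev e)%:R / M%:R <= x e) ->
  ((((c * (k * n.-1))%:R - (\sum_e (c - lev e))%N%:R) / M%:R)%:E
   <= min_weight k x)%E.
Proof.
move=> M0 xlev; apply/bigmin_geP; split=> [|F /asboolP FP]; first exact: leey.
rewrite lee_fin ler_pdivrMr ?ltr0n //.
have /= := disjoint_trees_level_sum c lev FP.
rewrite -(ler_nat R) natrD -lerBlDr => /le_trans; apply.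
rewrite natr_sum mulr_suml; apply: ler_sum => i _.
rewrite natr_sum mulr_suml; apply: ler_sum => e _.
by rewrite -ler_pdivrMr ?ltr0n.
Qed.

Lemma min_weight_ge0 x : (forall e, 0 <= x e) -> (0 <= min_weight k x)%E.
Proof.
move=> x0; apply/bigmin_geP; split=> [|F _]; first exact: leey.
by rewrite lee_fin sumr_ge0 // => i _; apply: sumr_ge0.
Qed.

End MinWeight.

(** * Averages over finite product spaces *)

Section Average.
Variable R : realType.
Implicit Types T : finType.

Definition avg T (f : T -> R) : R := (\sum_t f t) / #|T|%:R.

Lemma eq_avg T (f g : T -> R) : f =1 g -> avg f = avg g.
Proof. by move=> fg; congr (_ / _); apply: eq_bigr. Qed.

Lemma avg_le T (f g : T -> R) : (forall t, f t <= g t) -> avg f <= avg g.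
Proof. by move=> fg; rewrite ler_wpM2r ?invr_ge0 //; apply: ler_sum. Qed.

Lemma avg_ge0 T (f : T -> R) : (forall t, 0 <= f t) -> 0 <= avg f.
Proof. by move=> f0; rewrite divr_ge0 // sumr_ge0. Qed.

Lemma avgD T (f g : T -> R) : avg (fun t => f t + g t) = avg f + avg g.
Proof. by rewrite /avg big_split mulrDl. Qed.

Lemma avgB T (f g : T -> R) : avg (fun t => f t - g t) = avg f - avg g.
Proof. by rewrite /avg sumrB mulrBl. Qed.

Lemma avgZ T (a : R) (f : T -> R) : avg (fun t => a * f t) = a * avg f.
Proof. by rewrite /avg -mulr_sumr mulrA. Qed.

Lemma avgMr T (a : R) (f : T -> R) : avg (fun t => f t * a) = avg f * a.
Proof. by rewrite mulrC -avgZ; apply: eq_avg => t; rewrite mulrC. Qed.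

Lemma avg_sum T I (s : seq I) (P : pred I) (f : I -> T -> R) :
  avg (fun t => \sum_(i <- s | P i) f i t) = \sum_(i <- s | P i) avg (f i).
Proof. by rewrite /avg exchange_big mulr_suml. Qed.

Lemma avg_cst T (a : R) : (0 < #|T|)%N -> avg (fun _ : T => a) = a.
Proof.
by move=> T0; rewrite /avg sumr_const -(mulr_natr a) mulfK // pnatr_eq0 -lt0n.
Qed.

Lemma avg_mem T (P : pred T) : avg (fun t => (P t)%:R) = #|P|%:R / #|T|%:R.
Proof. by rewrite /avg -natr_sum -big_mkcond sum1_card. Qed.

Lemma avg_lt_exists T (f : T -> R) a : (0 < #|T|)%N -> avg f < a -> exists t, f t < a.
Proof.
move=> T0; apply: contraPP => /forallNP fa; apply/negP; rewrite -leNgt.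
by rewrite -(avg_cst a T0); apply: avg_le => t; rewrite leNgt; apply/negP.
Qed.

Lemma avg_bij T T' (h : T' -> T) (f : T -> R) : bijective h ->
  avg (fun t => f (h t)) = avg f.
Proof.
move=> hbij; rewrite /avg (bij_eq_card hbij); congr (_ / _).
by rewrite [RHS](reindex h) //; apply: onW_bij.
Qed.

Lemma avg_prod_type T T' (f : T * T' -> R) :
  avg f = avg (fun t => avg (fun t' => f (t, t'))).
Proof.
rewrite /avg -mulr_suml pair_bigA /= card_prod natrM invfM mulrCA mulrC.
by congr (_ * _ * _); apply: eq_bigr => -[].
Qed.

Section Coordinates.
Variables (E L : finType).
Hypothesis L0 : (0 < #|L|)%N.
Local Notation Omega := {ffun E -> L}.
Implicit Types (f g : Omega -> R) (S : {set E}).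

Lemma card_labels_gt0 : (0 < #|{: Omega}|)%N.
Proof. by rewrite card_ffun expn_gt0 L0. Qed.

Definition depends_on S f :=
  forall l l' : Omega, (forall e, e \in S -> l e = l' e) -> f l = f l'.

Lemma avg_indep S f g : depends_on S f -> depends_on (~: S)%SET g ->
  avg (fun l => f l * g l) = avg f * avg g.
Proof.
move=> fS gS.
(* Exchanging the coordinates in S between two independent copies is an
   involution of the pairs that keeps f l * g l' in a single copy. *)
pose mix (l l' : Omega) : Omega := [ffun e => if e \in S then l e else l' e].
pose swap (p : Omega * Omega) := (mix p.1 p.2, mix p.2 p.1).
have swapK : involutive swap.
  move=> [l l']; congr pair; apply/ffunP => e; rewrite !ffunE /=;
    by case: (e \in S).
have -> : avg f * avg g = avg (fun p : Omega * Omega => f p.1 * g p.2).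
  by rewrite avg_prod_type -avgMr; apply: eq_avg => l; rewrite -avgZ.
have -> : avg (fun p : Omega * Omega => f p.1 * g p.2) =
          avg (fun p => f (swap p).1 * g (swap p).1).
  apply: eq_avg => -[l l'] /=; congr (_ * _).
    by apply: fS => e eS; rewrite ffunE eS.
  by apply: gS => e; rewrite inE ffunE => /negPf ->.
rewrite (@avg_bij _ _ swap (fun p => f p.1 * g p.1)); last exact: inv_bij.
rewrite avg_prod_type; apply: eq_avg => l /=.
by rewrite avg_cst // card_labels_gt0.
Qed.

(** The sum over all functions factors over the coordinates, and each coordinate other than [e]
    contributes [#|L|]. *)
Lemma avg_coord (e : E) (h : L -> R) : avg (fun l : Omega => h (l e)) = avg h.
Proof.
rewrite /avg card_ffun natrX.
pose F (e' : E) (x : L) := if e' == e then h x else 1.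
have -> : \sum_(l : Omega) h (l e) = \sum_(l : Omega) \prod_e' F e' (l e').
  apply: eq_bigr => l _; rewrite (bigD1 e) //= {1}/F eqxx big1 ?mulr1 // => e'.
  by rewrite /F => /negPf ->.
rewrite -bigA_distr_bigA (bigD1 e) //= {1}/F eqxx.
have -> : \prod_(e' | e' != e) \sum_x F e' x = \prod_(e' | e' != e) #|L|%:R.
  by apply: eq_bigr => e' /negbTE ee'; rewrite /F ee' sumr_const.
rewrite prodr_const (eq_card (B := predC1 e)) // cardC1.
have L0' : #|L|%:R != 0 :> R by rewrite pnatr_eq0 -lt0n.
rewrite -[X in _ / _ ^+ X]prednK; last by apply/card_gt0P; exists e.
by rewrite exprS -mulf_div divff ?mulr1 // expf_neq0.
Qed.

Lemma avg_prod_indep (I : eqType) (s : seq I) (D : I -> {set E}) (f : I -> Omega -> R) :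
  (forall i, depends_on (D i) (f i)) -> pairwise (fun i j => D j \subset (~: D i)%SET) s ->
  avg (fun l => \prod_(i <- s) f i l) = \prod_(i <- s) avg (f i).
Proof.
move=> fD; elim: s => [_|i s IH] /=.
  rewrite big_nil -[RHS](avg_cst 1 card_labels_gt0).
  by apply: eq_avg => l; rewrite big_nil.
case/andP=> /allP /= is_ ps; rewrite big_cons -IH //.
rewrite -(@avg_indep (D i)) //; first by apply: eq_avg => l; rewrite big_cons.
move=> l l' ll'; apply: eq_big_seq => j /is_ /fintype.subsetP dij.
by apply: fD => e /dij /ll'.
Qed.

End Coordinates.

(** Cell indices and colours play different roles, the colours being averaged for fixed cell
    indices; this identity turns the iterated average into one over independent labels. *)
Lemma avg_ffun_pair (E A C : finType) (f : {ffun E -> A * C} -> R) :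
  avg (fun a : {ffun E -> A} => avg (fun c : {ffun E -> C} =>
    f [ffun e => (a e, c e)])) = avg f.
Proof.
pose h (p : {ffun E -> A} * {ffun E -> C}) : {ffun E -> A * C} :=
  [ffun e => (p.1 e, p.2 e)].
rewrite -(@avg_bij _ _ h f) ?avg_prod_type //.
exists (fun l : {ffun E -> A * C} =>
  ([ffun e => (l e).1] : {ffun E -> A}, [ffun e => (l e).2] : {ffun E -> C})).
  by move=> [a c]; congr pair; apply/ffunP => e; rewrite !ffunE.
by move=> l; apply/ffunP => e; rewrite !ffunE -surjective_pairing.
Qed.

End Average.

(** * Discretization of independent uniform weights *)

Section Discretization.
Context {R : realType} {d : measure_display} {T : measurableType d}.
Variable P : probability T R.

Lemma uniform01_itv (X : {RV P >-> R}) (a b : R) : uniform01 X ->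
  0 <= a -> a <= b -> b <= 1 -> P (X @^-1` `]a, b]) = (b - a)%:E.
Proof.
move=> uX a0 ab b1; have mA : measurable (`]a, b]%classic : set R) by exact: measurable_itv.
have /= -> : P (X @^-1` `]a, b]) = distribution P X `]a, b] by [].
rewrite uX // -[X in uniform_prob _ X]setIT.
(* The measure of the interval is rewritten as the integral of its indicator, which the uniform
   density turns into a Lebesgue integral. *)
rewrite -(integral_indic (uniform_prob (@ltr01 R)) measurableT mA).
rewrite integral_uniform //; last first.
  exact/measurable_EFinP/measurable_indic.
rewrite integral_indic //= subr0 invr1 mul1e.
have -> : `]a, b]%classic `&` `[0, 1]%classic = `]a, b]%classic :> set R.
  apply/setIidPl => x /=; rewrite !in_itv /= => /andP[ax xb].
  by rewrite (le_trans a0 (ltW ax)) (le_trans xb b1).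
rewrite lebesgue_measure_itv /= lte_fin; case: ltP => [_|ba]; first by rewrite EFinB.
have -> : a = b by apply/eqP; rewrite eq_le ab.
by rewrite subrr.
Qed.

Variables (E : finType) (X : E -> {RV P >-> R}) (M : nat).
Hypotheses (M0 : (0 < M)%N) (uX : forall e, uniform01 (X e)).
Hypothesis (iX : mutually_independent X).

(** Cells are open on the left, so that they partition []0, 1]] and no point lies in two of them. *)
Definition cell (i : nat) : set R := `]i%:R / M%:R, i.+1%:R / M%:R].

Definition in_cells (l : {ffun E -> 'I_M}) : set T :=
  [set w | forall e, cell (l e) (X e w)].

Let Mgt0 : 0 < M%:R :> R. Proof. by rewrite ltr0n. Qed.

Lemma P_all (A : E -> set R) : (forall e, measurable (A e)) ->
  P [set w | forall e, A e (X e w)] = (\prod_e P (X e @^-1` A e))%E.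
Proof.
move=> mA; have := iX [set: E]%SET mA.
rewrite (eq_bigl xpredT) => [<-|e]; last by rewrite finset.in_setT.
by congr (P _); apply/seteqP; split=> w /= H e; [move=> _|]; apply: H; rewrite ?finset.in_setT.
Qed.

Lemma measurable_all (A : E -> set R) : (forall e, measurable (A e)) ->
  measurable [set w | forall e, A e (X e w)].
Proof.
move=> mA; have -> : [set w | forall e, A e (X e w)] = \bigcap_(e in [set: E]) (X e @^-1` A e).
  by apply/seteqP; split=> w /= H e => [_|]; apply: H.
apply: fin_bigcap_measurable => // e _.
by rewrite -[X in measurable X]setTI; apply: measurable_funP.
Qed.

Lemma measurable_cells l : measurable (in_cells l).
Proof. by apply: (@measurable_all (fun e => cell (l e))) => e; apply: measurable_itv. Qed.

Lemma P_cells l : P (in_cells l) = ((M%:R^-1) ^+ #|E|)%:E.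
Proof.
rewrite (P_all (A := fun e => cell (l e))) => [|e]; last exact: measurable_itv.
rewrite (eq_bigr (fun=> (M%:R^-1)%:E)) => [|e _]; last first.
  have -> : M%:R^-1 = (l e).+1%:R / M%:R - (l e)%:R / M%:R :> R.
    by rewrite -mulrBl -natrB // subSnn mul1r.
  apply: uniform01_itv => //.
    by rewrite ler_wpM2r ?invr_ge0 // ler_nat.
  by rewrite ler_pdivrMr // mul1r ler_nat.
by rewrite prodEFin prodr_const.
Qed.

(** This is the union of the boxes [in_cells l], described without [M]; its complement is a null
    event. *)
Definition all_cells : set T := [set w | forall e, `]0, 1]%classic (X e w)].

Lemma measurable_all_cells : measurable all_cells.
Proof. by apply: (@measurable_all (fun=> `]0, 1]%classic)) => e; apply: measurable_itv. Qed.

Lemma P_all_cells : P all_cells = 1%E.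
Proof.
rewrite (P_all (A := fun=> `]0, 1]%classic)) => [|e]; last exact: measurable_itv.
rewrite big1 // => e _; by rewrite uniform01_itv // subr0.
Qed.

Lemma in_cells_inj w l l' : in_cells l w -> in_cells l' w -> l = l'.
Proof.
move=> lw lw'; apply/ffunP => e; apply/val_inj => /=.
have := lw e; have := lw' e; rewrite /cell /= !in_itv /= !ltr_pdivrMr // !ler_pdivlMr //.
move=> /andP[a b] /andP[a' b'].
have := lt_le_trans a b'; have := lt_le_trans a' b; rewrite !ltr_nat !ltnS.
by move=> h h'; apply/eqP; rewrite eqn_leq h h'.
Qed.

Lemma all_cells_in_cells w : all_cells w -> exists l, in_cells l w.
Proof.
move=> Uw; suff /fin_all_exists [l lw] : forall e, exists i : 'I_M, cell i (X e w).
  by exists [ffun e => l e] => e; rewrite ffunE.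
move=> e; have := Uw e; rewrite /= in_itv /= => /andP[x0 x1].
have ex : exists m, X e w <= m.+1%:R / M%:R.
  by exists M.-1; rewrite prednK // divff // gt_eqF.
have [m xm mmin] := ex_minnP ex.
have mM : (m < M)%N.
  have : (m <= M.-1)%N by apply: mmin; rewrite prednK // divff // gt_eqF.
  by move=> h; apply: leq_ltn_trans h _; rewrite prednK.
exists (Ordinal mM); rewrite /cell /= in_itv /= xm andbT.
case: m xm mmin mM => [|m] xm mmin mM; first by rewrite mul0r.
by rewrite ltNge; apply/negP => /mmin; rewrite ltnn.
Qed.

Lemma in_cells_all_cells w l : in_cells l w -> all_cells w.
Proof.
move=> lw e; have := lw e; rewrite /cell /= !in_itv /= => /andP[a b]; apply/andP; split.
  by apply: le_lt_trans a; rewrite divr_ge0.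
by apply: le_trans b _; rewrite ler_pdivrMr // mul1r ler_nat.
Qed.

Lemma integral_all_cells (f : T -> \bar R) : measurable_fun [set: T] f ->
  (\int[P]_w f w = \int[P]_w (f \_ all_cells) w)%E.
Proof.
move=> mf; apply: ae_eq_integral => //.
  apply/(measurable_restrictT f measurable_all_cells).
  exact: measurable_funS mf.
exists (~` all_cells); split.
- exact/measurableC/measurable_all_cells.
- have := probability_setC P measurable_all_cells; rewrite P_all_cells subee //.
move=> w /= H Uw; apply: H => _; rewrite patchE ifT //; exact: mem_set.
Qed.

(** By independence all boxes have the same probability, so the integral of a step function is the
    plain average of its values. *)
Lemma integral_cells (G : {ffun E -> 'I_M} -> R) : (forall l, 0 <= G l) ->
  (\int[P]_w (\sum_l (G l * \1_(in_cells l) w)%:E) = (avg G)%:E)%E.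
Proof.
move=> G0.
have mI l : measurable_fun [set: T] (fun w => (\1_(in_cells l) w : R)%:E).
  exact/measurable_EFinP/measurable_indic/measurable_cells.
have mGI l : measurable_fun [set: T] (fun w => (G l * \1_(in_cells l) w)%:E).
  apply/measurable_EFinP/measurable_funM => //.
  exact/measurable_indic/measurable_cells.
have GI0 l w : [set: T] w -> (0 <= (G l * \1_(in_cells l) w)%:E)%E.
  by move=> _; rewrite lee_fin mulr_ge0.
have I0 l w : [set: T] w -> (0 <= (\1_(in_cells l) w : R)%:E)%E.
  by move=> _; rewrite lee_fin.
rewrite (ge0_integral_sum P measurableT mGI GI0).
rewrite /avg mulr_suml -sumEFin; apply: eq_bigr => l _.
have mul w : ((G l * \1_(in_cells l) w)%:E = (G l)%:E * (\1_(in_cells l) w)%:E)%E by [].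
under eq_integral do rewrite mul.
rewrite (ge0_integralZl P measurableT (mI l) (I0 l)); last by rewrite lee_fin.
rewrite integral_indic //; last exact: measurable_cells.
rewrite setIT EFinM card_ffun card_ord natrX -exprVn; congr (_ * _)%E.
exact: P_cells.
Qed.

Lemma sum_cells (G : {ffun E -> 'I_M} -> R) w l : in_cells l w ->
  (\sum_l (G l * \1_(in_cells l) w)%:E = (G l)%:E)%E.
Proof.
move=> lw; rewrite (bigD1 l) //= indicE mem_set // mulr1 big1 ?adde0 // => l' l'l.
rewrite indicE memNset ?mulr0 // => lw'.
by rewrite (in_cells_inj lw lw') eqxx in l'l.
Qed.

Lemma integral_le_avg (f : T -> \bar R) (G : {ffun E -> 'I_M} -> R) :
  measurable_fun [set: T] f -> (forall l, 0 <= G l) ->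
  (forall l w, in_cells l w -> (0 <= f w <= (G l)%:E)%E) ->
  (\int[P]_w f w <= (avg G)%:E)%E.
Proof.
move=> mf G0 fG; rewrite integral_all_cells // -integral_cells //.
apply: ge0_le_integral => //.
- move=> w _; rewrite patchE; case: ifP => // /set_mem /all_cells_in_cells [l /fG].
  by case/andP.
- by apply/(measurable_restrictT f measurable_all_cells); apply: measurable_funS mf.
- apply: emeasurable_sum => l; apply/measurable_EFinP/measurable_funM => //.
  exact/measurable_indic/measurable_cells.
- move=> w _; rewrite patchE; case: ifP => [/set_mem /all_cells_in_cells [l lw]|_].
    by rewrite (sum_cells _ lw); case/andP: (fG _ _ lw).
  by apply: sume_ge0 => l _; rewrite lee_fin mulr_ge0.
Qed.

Lemma integral_ge_avg (f : T -> \bar R) (G : {ffun E -> 'I_M} -> R) :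
  measurable_fun [set: T] f ->
  (forall l w, in_cells l w -> (0 <= f w /\ (G l)%:E <= f w)%E) ->
  ((avg G)%:E <= \int[P]_w f w)%E.
Proof.
(* The lower bound [G] may be negative, whereas the comparison of integrals is made between
   nonnegative functions; since [f] is nonnegative on the boxes, [G] may be replaced by its positive
   part. *)
move=> mf fG; apply: (@le_trans _ _ (avg (fun l => Num.max 0 (G l)))%:E).
  by rewrite lee_fin; apply: avg_le => l; rewrite le_max lexx orbT.
have G0 l : 0 <= Num.max 0 (G l) by rewrite le_max lexx.
rewrite integral_all_cells // -integral_cells //.
apply: ge0_le_integral => //.
- by move=> w _; apply: sume_ge0 => l _; rewrite lee_fin mulr_ge0.
- apply: emeasurable_sum => l; apply/measurable_EFinP/measurable_funM => //.
  exact/measurable_indic/measurable_cells.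
- by apply/(measurable_restrictT f measurable_all_cells); apply: measurable_funS mf.
- move=> w _; rewrite patchE; case: ifP => [/set_mem /all_cells_in_cells [l lw]|].
    by rewrite (sum_cells _ lw) EFin_max ge_max; case: (fG _ _ lw) => -> ->.
  move=> /negP wU; rewrite big1 // => l _; rewrite indicE memNset ?mulr0 //.
  by move=> /in_cells_all_cells /mem_set.
Qed.

End Discretization.

Lemma measurable_min_weight (R : realType) (d : measure_display)
    (T : measurableType d) (P : probability T R) (n k : nat)
    (X : edge n -> {RV P >-> R}) :
  measurable_fun [set: T] (fun w => min_weight k (fun e => X e w)).
Proof.
rewrite /min_weight; elim: (index_enum _) => [|F s IH].
  by under eq_fun do rewrite big_nil; exact: measurable_cst.
under eq_fun do rewrite big_cons.
case: `[< disjoint_spanning_trees F >] => //.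
apply: measurable_mine => //; apply/measurable_EFinP.
apply: measurable_sum => i /=.
under eq_fun do rewrite big_mkcond.
apply: measurable_sum => e; case: (e \in F i); last exact: measurable_cst.
exact: measurable_funP.
Qed.

(** * Components of a random graph *)

Section EdgeOf.
Variables (n : nat) (e0 : edge n).
Implicit Types u v w : 'I_n.

(** The edge [e0] is a default, taken when [u = v] and the pair is not an edge. *)
Definition edge_of u v : edge n := insubd e0 [set u; v]%SET.

Lemma val_edge_of u v : u != v -> val (edge_of u v) = [set u; v]%SET.
Proof. by move=> uv; rewrite val_insubd cards2 uv. Qed.

Lemma edge_of_inj u v u' v' : u != v -> u' != v' -> edge_of u v = edge_of u' v' ->
  (u = u' /\ v = v') \/ (u = v' /\ v = u').
Proof.
move=> uv uv' /(congr1 val); rewrite !val_edge_of // => E.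
have := finset.set21 u v; have := finset.set22 u v; rewrite E.
move=> /set2P[] ? /set2P[] ?; subst; auto; by rewrite eqxx in uv.
Qed.

Lemma edge_of_injr u : {in [pred v | v != u] &, injective (edge_of u)}.
Proof.
move=> v w; rewrite !inE ![_ == u]eq_sym => uv uw /(edge_of_inj uv uw).
by case=> [[]|[-> ->]].
Qed.

Lemma card_edges : (#|{: edge n}| * 2 = n * n.-1)%N.
Proof.
have -> : #|{: edge n}| = 'C(n, 2).
  rewrite card_sig -[n in RHS]card_ord -card_draws.
  by apply: eq_card => A; rewrite !inE.
by have := bin_ffact n 2; rewrite ffactnS ffactn1.
Qed.

End EdgeOf.

Section RandomGraph.
Variables (R : realType) (n : nat) (e0 : edge n) (L : finType) (hit : pred L).
Hypothesis L0 : (0 < #|L|)%N.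
Notation Omega := {ffun edge n -> L}.
Let q : R := #|hit|%:R / #|L|%:R.

Definition random_graph (l : Omega) : {set edge n} := [set e | hit (l e)]%SET.

Let h u v (l : Omega) : R := (hit (l (edge_of e0 u v)))%:R.

Let avg_h u v : avg (h u v) = q.
Proof. by rewrite (@avg_coord _ _ _ L0 _ (fun x => (hit x)%:R)) avg_mem. Qed.

Let dep_h u v : depends_on [set edge_of e0 u v]%SET (h u v).
Proof. by move=> l l' ll'; rewrite /h ll' // inE. Qed.

Let joined_h u v (l : Omega) : u != v -> hit (l (edge_of e0 u v)) ->
  connect (adjacent (random_graph l)) u v.
Proof.
move=> uv huv; apply: connect1; apply: (@adjacent_mem _ _ (edge_of e0 u v)).
  by rewrite inE.
exact: val_edge_of.
Qed.

Let q01 : 0 <= q <= 1.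
Proof.
rewrite divr_ge0 //= ler_pdivrMr ?ltr0n // mul1r ler_nat.
exact: max_card.
Qed.

Let dep_prod (s : seq 'I_n) w : uniq s ->
  depends_on [set edge_of e0 w v | v in s]%SET (fun l => \prod_(v <- s) (1 - h w v l)).
Proof.
move=> us l l' ll'; apply: eq_big_seq => v vs; congr (1 - _).
by apply: dep_h => e; rewrite inE => /eqP ->; apply: ll'; apply: imset_f.
Qed.

Let avg_prod (s : seq 'I_n) w : uniq s -> w \notin s ->
  avg (fun l => \prod_(v <- s) (1 - h w v l)) = (1 - q) ^+ size s.
Proof.
move=> us ws.
rewrite (@avg_prod_indep _ _ _ L0 _ s (fun v => [set edge_of e0 w v]%SET)
   (fun v l => 1 - h w v l)).
- rewrite (eq_bigr (fun=> 1 - q)) => [|v _].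
    by elim: s {us ws} => [|v s IH]; rewrite ?big_nil ?expr0 // big_cons exprS IH.
  by rewrite avgB avg_cst ?card_labels_gt0 // avg_h.
- by move=> v l l' ll'; congr (1 - _); apply: dep_h.
- rewrite uniq_pairwise in us.
  apply: (@sub_in_pairwise _ (mem s) _ _ _ s (allss s) us) => u v us' vs /= uv.
  apply/fintype.subsetP => e; rewrite !inE => /eqP ->; apply: contra uv => /eqP.
  move/edge_of_injr => -> //; rewrite inE; first by apply: contraNneq ws => <-.
  by apply: contraNneq ws => <-.
Qed.

Let h01 u v (l : Omega) : 0 <= 1 - h u v l <= 1.
Proof. by rewrite /h; case: (hit _); rewrite ?subrr ?subr0 ?lexx ?ler01. Qed.

Let size_below m : (m <= n)%N -> size [seq v : 'I_n <- enum 'I_n | (v < m)%N] = m.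
Proof.
move=> mn; rewrite size_filter -(count_map val (fun v => v < m)%N) val_enum_ord.
rewrite -(subnKC mn) iotaD count_cat add0n.
rewrite (_ : count _ (iota 0 m) = m); last first.
  rewrite -[RHS](size_iota 0 m); apply/eqP; rewrite -all_count; apply/allP => i.
  by rewrite mem_iota.
rewrite (_ : count _ _ = 0%N) ?addn0 //; apply/eqP; rewrite -leqn0 leqNgt -has_count.
by apply/hasPn => i; rewrite mem_iota -leqNgt => /andP[].
Qed.

Let prod_mem_roots (u : 'I_n) (s : seq 'I_n) (f : 'I_n -> Omega -> R) (l : Omega) :
  (forall v, 0 <= f v l) ->
  (forall v, v \in s -> u \in roots (random_graph l) -> f v l = 1) ->
  (u \in roots (random_graph l))%:R <= \prod_(v <- s) f v l.
Proof.
move=> f0 f1; have [ur|_] := boolP (u \in _); last exact: prodr_ge0.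
by rewrite big_seq big1 // => v /f1; apply.
Qed.

Let not_hit (u v : 'I_n) (l : Omega) : u \in roots (random_graph l) -> (v < u)%N ->
  ~ connect (adjacent (random_graph l)) u v.
Proof.
by move=> /rootsP[_ umin] vu; rewrite joined_sym => /umin; rewrite leqNgt vu.
Qed.

(* A root u >= 2b has no edge to the vertices below 2b; for a root u < 2b, no
   vertex w >= 2b is adjacent both to u and to some v < u. *)
Lemma avg_mem_roots (b : nat) (u : 'I_n) : (4 * b <= n)%N -> (0 < u)%N ->
  avg (fun l : Omega => (u \in roots (random_graph l))%:R) <=
    (1 - q * (1 - (1 - q) ^+ u)) ^+ (2 * b).
Proof.
move=> bn u0; case/andP: q01 => q0 q1.
have b2n : (2 * b <= n)%N by apply: leq_trans bn; rewrite leq_mul2r orbT.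
have p01 : 0 <= 1 - q <= 1 by rewrite subr_ge0 q1 lerBlDr lerDl.
have pu01 : 0 <= (1 - q) ^+ u <= 1.
  by case/andP: p01 => ? ?; rewrite exprn_ge0 // exprn_ile1.
(* The bound to be shown is the one natural for [u < 2 * b]; this comparison lets the other case,
   which gives [(1 - q) ^+ (2 * b)], fit the same formula. *)
have base1 : 1 - q <= 1 - q * (1 - (1 - q) ^+ u).
  by case/andP: pu01 => ? ?; rewrite lerD2l lerN2 ler_piMr // lerBlDr lerDl.
have base2 : 1 - q * (1 - (1 - q) ^+ u) <= 1.
  by rewrite lerBlDr lerDl mulr_ge0 // subr_ge0; case/andP: pu01.
have [ub|ub] := leqP (2 * b) u.
  pose s := [seq v : 'I_n <- enum 'I_n | (v < 2 * b)%N].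
  have us : u \notin s by rewrite mem_filter negb_and -leqNgt ub.
  apply: (@le_trans _ _ (avg (fun l => \prod_(v <- s) (1 - h u v l)))).
    apply: avg_le => l; apply: (prod_mem_roots (f := fun v l => 1 - h u v l)).
      by move=> v; case/andP: (h01 u v l).
    move=> v; rewrite mem_filter => /andP[vb _] ur; rewrite /h /=.
    have vu : (v < u)%N := leq_trans vb ub.
    case huv : (hit _); last by rewrite subr0.
    by case: (not_hit ur vu); apply: joined_h; rewrite // -val_eqE gtn_eqF.
  have size_s : size s = (2 * b)%N by rewrite size_below.
  have suniq : uniq s by rewrite filter_uniq // enum_uniq.
  case/andP: p01 => p0 _; rewrite avg_prod // size_s.
  by apply: lerXn2r; rewrite ?nnegrE // (le_trans p0).
pose s := [seq w : 'I_n <- enum 'I_n | (2 * b <= w)%N].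
pose t := [seq v : 'I_n <- enum 'I_n | (v < u)%N].
have ut : u \notin t by rewrite mem_filter ltnn.
have tuniq : uniq t by rewrite filter_uniq // enum_uniq.
have suniq : uniq s by rewrite filter_uniq // enum_uniq.
have size_s : (2 * b <= size s)%N.
  have := count_predC (fun v : 'I_n => (v < 2 * b)%N) (enum 'I_n).
  rewrite -!size_filter size_below // size_enum_ord.
  rewrite (eq_filter (a2 := fun w : 'I_n => (2 * b <= w)%N)) -/s => [sE|w /=].
    by rewrite -(leq_add2l (2 * b)) sE -mulnDl.
  by rewrite -leqNgt.
have st w v : w \in s -> v \in u :: t -> (v < w)%N.
  rewrite mem_filter => /andP[bw _]; rewrite inE mem_filter => /predU1P[->|/andP[vu _]].
    exact: leq_trans bw.
  exact: leq_trans (ltn_trans vu ub) bw.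
(* This is the indicator that [w] is not adjacent both to [u] and to some [v < u]. Distinct [w]
   involve disjoint sets of edges, so the average of the product factors. *)
pose f w l := 1 - h w u l * (1 - \prod_(v <- t) (1 - h w v l)).
have prod01 w l : 0 <= \prod_(v <- t) (1 - h w v l) <= 1.
  apply/andP; split; first by apply: prodr_ge0 => v _; case/andP: (h01 w v l).
  by apply: prodr_ile1 => v _; apply: h01.
apply: (@le_trans _ _ (avg (fun l => \prod_(w <- s) f w l))).
  apply: avg_le => l; apply: (prod_mem_roots (f := f)).
    move=> w; rewrite /f /h; case: (hit _); rewrite ?mul0r ?subr0 // mul1r opprB addrC subrK.
    by case/andP: (prod01 w l).
  move=> w ws ur; rewrite /f /h; case hwu : (hit _); last by rewrite mul0r subr0.
  rewrite big_seq big1 ?subrr ?mulr0 ?subr0 // => v vt.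
  case hwv : (hit _); last by rewrite subr0.
  have vu : (v < u)%N by move: vt; rewrite mem_filter => /andP[].
  case: (not_hit ur vu); apply: (@connect_trans _ _ w).
    rewrite joined_sym; apply: joined_h => //.
    by rewrite -val_eqE gtn_eqF // st // mem_head.
  by apply: joined_h => //; rewrite -val_eqE gtn_eqF // st // inE vt orbT.
rewrite (@avg_prod_indep _ _ _ L0 _ s
  (fun w => [set edge_of e0 w v | v in u :: t]%SET) f); last 2 first.
- move=> w l l' ll'; rewrite /f; congr (1 - _ * (1 - _)).
    by apply: dep_h => e; rewrite inE => /eqP ->; apply/ll'/imset_f/mem_head.
  apply: (dep_prod (w := w) tuniq) => e /imsetP[v vt ->].
  by apply/ll'/imset_f; rewrite inE vt orbT.
- move: suniq; rewrite uniq_pairwise => /(sub_in_pairwise _ (allss s)); apply.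
  move=> w w' ws ws' /= ww'; apply/fintype.subsetP => _ /imsetP[v' v't ->].
  rewrite inE; apply/negP => /imsetP[v vt] /edge_of_inj [].
  - by rewrite -val_eqE gtn_eqF // st.
  - by rewrite -val_eqE gtn_eqF // st.
  - by case=> E; rewrite E eqxx in ww'.
  - case=> E E'; have := st _ _ ws' v't; have := st _ _ ws vt; rewrite E E'.
    by move=> lt1 /(ltn_trans lt1); rewrite ltnn.
have avg_f w : w \in s -> avg (f w) = 1 - q * (1 - (1 - q) ^+ u).
  move=> ws; rewrite avgB avg_cst ?card_labels_gt0 //; congr (1 - _).
  have wt : w \notin t.
    by apply/negP => wt; have := st w w ws; rewrite inE wt orbT ltnn => /(_ isT).
  have size_t : size t = u by rewrite size_below // ltnW.
  rewrite (@avg_indep _ _ _ L0 [set edge_of e0 w u]%SET) //.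
  - by rewrite avg_h avgB avg_cst ?card_labels_gt0 // avg_prod // size_t.
  - move=> l l' ll'; congr (1 - _); apply: (dep_prod (w := w) tuniq) => e /imsetP[v vt ->].
    apply: ll'; rewrite !inE; apply/eqP => /edge_of_injr; rewrite !inE.
    have vw : v != w by rewrite -val_eqE ltn_eqF // st // inE vt orbT.
    have uw : u != w by rewrite -val_eqE ltn_eqF // st // mem_head.
    by move=> /(_ vw uw) vE; rewrite -vE vt in ut.
rewrite big_seq (eq_bigr _ avg_f) -big_seq.
have -> : \prod_(w <- s) (1 - q * (1 - (1 - q) ^+ u)) =
    (1 - q * (1 - (1 - q) ^+ u)) ^+ size s.
  by elim: (s) => [|w s' IH]; rewrite ?big_nil ?expr0 // big_cons exprS IH.
apply: ler_wiXn2l => //; apply: le_trans base1; by case/andP: p01.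
Qed.

End RandomGraph.

(** * Summing the root probabilities over the vertices *)

Section Bernoulli.
Variable R : realType.
Implicit Types (x q : R).

(** The induction step is [(1 - x) * (1 + (b + 1) * x) <= 1 + b * x], whose two sides differ by
    [(b + 1) * x ^ 2]. *)
Lemma expr_bernoulli x (b : nat) : 0 <= x <= 1 -> (1 - x) ^+ b <= (1 + b%:R * x)^-1.
Proof.
move=> /andP[x0 x1].
have pos (m : nat) : 0 < 1 + m%:R * x by rewrite ltr_pwDl // mulr_ge0.
elim: b => [|b IH]; first by rewrite expr0 mul0r addr0 invr1.
rewrite exprS; apply: le_trans (ler_wpM2l _ IH) _; first by rewrite subr_ge0.
rewrite ler_pdivrMr ?pos // [leRHS]mulrC ler_pdivlMr ?pos //.
have b0 : 0 <= b%:R :> R by [].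
rewrite -natr1; nra.
Qed.

Lemma sum_inv_sqr_le (a : R) (n : nat) : 0 < a ->
  \sum_(u < n | (0 < u)%N) (1 + a * u%:R)^-1 ^+ 2 <= a^-1.
Proof.
move=> a0; have pos (m : nat) : 0 < 1 + a * m%:R by rewrite ltr_pwDl // mulr_ge0 // ltW.
(* The sum telescopes: a term is at most the product of two consecutive inverses, which is their
   difference divided by [a]. The remainder is kept for the induction. *)
have : \sum_(u < n | (0 < u)%N) (1 + a * u%:R)^-1 ^+ 2 <=
    a^-1 * (1 - (1 + a * n.-1%:R)^-1).
  elim: n => [|[|n] IH].
  - by rewrite big_ord0 /= mulr0 addr0 invr1 subrr mulr0.
  - by rewrite big_mkcond big_ord1 /= mulr0 addr0 invr1 subrr mulr0.
  rewrite big_mkcond big_ord_recr -big_mkcond /=; apply: le_trans (lerD IH (lexx _)) _.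
  set A := (1 + a * n%:R)^-1; set C := (1 + a * n.+1%:R)^-1.
  have -> : a^-1 * (1 - C) = a^-1 * (1 - A) + a^-1 * (A - C) by ring.
  have -> : A - C = a * (A * C).
    rewrite /A /C -natr1; have := pos n; have := pos n.+1; rewrite -natr1 => p1 p2.
    by field; rewrite !gt_eqF.
  rewrite lerD2l mulrA mulVf ?gt_eqF // mul1r expr2 ler_wpM2r //.
    by rewrite invr_ge0 ltW.
  by rewrite /A /C lef_pV2 ?posrE ?pos // lerD2l ler_wpM2l ?ler_nat // ltW.
move=> /le_trans; apply; rewrite ler_piMr ?invr_ge0 ?(ltW a0) //.
by rewrite lerBlDr lerDl invr_ge0 ltW.
Qed.

End Bernoulli.

Section RandomGraphRoots.
Variables (R : realType) (n : nat) (e0 : edge n) (L : finType) (hit : pred L).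
Hypothesis L0 : (0 < #|L|)%N.
Let q : R := #|hit|%:R / #|L|%:R.
Variable b : nat.
Hypotheses (b0 : (0 < b)%N) (bn : (4 * b <= n)%N) (q0 : 0 < q).

Let q1 : q <= 1.
Proof. by rewrite ler_pdivrMr ?ltr0n // mul1r ler_nat max_card. Qed.

Let base (u : nat) : (0 < u)%N -> 
  (u%:R * q) / (1 + u%:R * q) <= 1 - (1 - q) ^+ u.
Proof.
move=> u0; have p : 0 < 1 + u%:R * q by rewrite ltr_pwDl // mulr_ge0 // ltW.
rewrite lerBrDr -lerBrDl; apply: le_trans (expr_bernoulli _ _) _; first by rewrite (ltW q0) q1.
by rewrite le_eqVlt; apply/orP; left; apply/eqP; field; rewrite gt_eqF.
Qed.

Let avg_card_roots_sum (g : nat -> R) :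
  (forall u, (0 < u)%N -> (1 - q * (1 - (1 - q) ^+ u)) ^+ (2 * b) <= g u) ->
  avg (fun l : {ffun edge n -> L} => #|roots (random_graph hit l)|%:R) <=
  \sum_(u < n | (0 < u)%N) g u.
Proof.
move=> bound.
rewrite (@eq_avg _ _ _ (fun l : {ffun edge n -> L} =>
    \sum_(u < n | (0 < u)%N) (u \in roots (random_graph hit l))%:R)); last first.
  move=> l; rewrite -sum1_card natr_sum big_mkcond [RHS]big_mkcond.
  apply: eq_bigr => u _; case: ifP => [/rootsP[-> _]//|_]; by rewrite if_same.
rewrite avg_sum; apply: ler_sum => u u0; apply: le_trans (bound u u0).
exact: (@avg_mem_roots R n e0 L hit L0 b u bn u0).
Qed.

(** The probability that [u] is a root is a [b]-th power squared. With [y = u * q], the fraction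
    [y / (1 + y)] is at least [y / 2] when [y <= 1] and at least [1 / 2] otherwise. The first case
    gives the summable terms [(1 + a * u)^-1 ^+ 2] with total at most [a^-1]; the second gives at
    most [n] terms below [z^-1 ^+ 2]. *)
Lemma avg_card_roots :
  avg (fun l : {ffun edge n -> L} => #|roots (random_graph hit l)|%:R) <=
    2 / (b%:R * q ^+ 2) + 4 * n%:R / (b%:R * q) ^+ 2.
Proof.
have br : 0 < b%:R :> R by rewrite ltr0n.
pose a := b%:R * q ^+ 2 / 2; pose z := b%:R * q / 2.
have a0 : 0 < a by rewrite divr_gt0 // mulr_gt0 // exprn_gt0.
have z0 : 0 < z by rewrite divr_gt0 // mulr_gt0.
pose g (u : nat) : R := (1 + a * u%:R)^-1 ^+ 2 + (1 + z)^-1 ^+ 2.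
apply: (@le_trans _ _ (\sum_(u < n | (0 < u)%N) g u)).
  apply: avg_card_roots_sum => u u0.
  have ur : 0 < u%:R :> R by rewrite ltr0n.
  pose y := u%:R * q; have y0 : 0 < y by rewrite mulr_gt0.
  have x01 : 0 <= q * (1 - (1 - q) ^+ u) <= 1.
    have p0 : 0 <= 1 - q by rewrite subr_ge0.
    have p1 : 1 - q <= 1 by rewrite lerBlDr lerDl ltW.
    have := exprn_ge0 u p0; have := exprn_ile1 u p0 p1; nra.
  have xy : q * (y / (1 + y)) <= q * (1 - (1 - q) ^+ u).
    by rewrite ler_wpM2l ?base // ltW.
  pose v := 1 + b%:R * (q * (y / (1 + y))).
  have v1 : 1 <= v.
    by rewrite lerDl mulr_ge0 // mulr_ge0 ?(ltW q0) // divr_ge0 ?addr_ge0 ?(ltW y0).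
  have v0 : 0 < v by apply: lt_le_trans v1.
  have inv_le (s t : R) : 0 < s -> s <= t -> t^-1 ^+ 2 <= s^-1 ^+ 2.
    move=> s0 st; have t0 := lt_le_trans s0 st.
    by apply: lerXn2r; rewrite ?nnegrE ?invr_ge0 ?(ltW s0) ?(ltW t0) // lef_pV2.
  have az0 : 0 < 1 + a * u%:R by rewrite ltr_pwDl // mulr_ge0 ?(ltW a0).
  have z1 : 0 < 1 + z by rewrite ltr_pwDl // (ltW z0).
  rewrite mulnC exprM; apply: (@le_trans _ _ (v^-1 ^+ 2)).
    have b1 : (1 - q * (1 - (1 - q) ^+ u)) ^+ b <= v^-1.
      apply: le_trans (expr_bernoulli _ x01) _; case/andP: x01 => x0 _.
      have vw : v <= 1 + b%:R * (q * (1 - (1 - q) ^+ u)) by rewrite lerD2l ler_wpM2l.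
      by rewrite lef_pV2 ?posrE // (lt_le_trans v0).
    apply: lerXn2r b1; rewrite nnegrE ?invr_ge0 ?(ltW v0) //.
    by rewrite exprn_ge0 // subr_ge0; case/andP: x01.
  have [y1|/ltW y1] := leP y 1.
    apply: (@le_trans _ _ ((1 + a * u%:R)^-1 ^+ 2)); last first.
      by rewrite lerDl exprn_ge0 // invr_ge0 (ltW z1).
    apply: inv_le az0 _.
    have -> : a * u%:R = b%:R * (q * (y / 2)) by rewrite /a /y; field.
    rewrite lerD2l ler_wpM2l // ler_wpM2l ?(ltW q0) // ler_wpM2l ?(ltW y0) //.
    by rewrite lef_pV2 ?posrE //; lra.
  apply: (@le_trans _ _ ((1 + z)^-1 ^+ 2)); last first.
    by rewrite lerDr exprn_ge0 // invr_ge0 (ltW az0).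
  apply: inv_le z1 _.
  have -> : z = b%:R * (q * 2^-1) by rewrite /z mulrA.
  rewrite lerD2l ler_wpM2l // ler_wpM2l ?(ltW q0) // ler_pdivlMr; last by lra.
  by rewrite mulrC ler_pdivrMr //; lra.
rewrite big_split /=; apply: lerD.
  apply: le_trans (sum_inv_sqr_le _ a0) _.
  by rewrite /a invf_div.
apply: (@le_trans _ _ (\sum_(u < n) (1 + z)^-1 ^+ 2)).
  rewrite big_mkcond /=; apply: ler_sum => u _; case: ifP => // _.
  by rewrite exprn_ge0 // invr_ge0 addr_ge0 // ltW.
rewrite sumr_const card_ord -[_ *+ n]mulr_natl [4 * _]mulrC -mulrA ler_wpM2l //.
have -> : 4 / (b%:R * q) ^+ 2 = z^-1 ^+ 2.
  by rewrite /z; field; rewrite !gt_eqF.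
rewrite ler_sqr ?nnegrE ?invr_ge0 ?addr_ge0 ?(ltW z0) //.
by rewrite lef_pV2 ?posrE ?ltr_pwDl ?(ltW z0) // lerDr.
Qed.

(** For [u >= 1] the quantity [1 - (1 - q) ^+ u] is at least [q]. The exponential decay in [b]
    serves at constant density, where disconnection must be rarer than any fixed negative power of
    [n] needed to offset the crude bound. *)
Lemma avg_card_roots_exp :
  avg (fun l : {ffun edge n -> L} => #|roots (random_graph hit l)|%:R) <=
    n%:R * (1 - q ^+ 2) ^+ (2 * b).
Proof.
have p0 : 0 <= 1 - q by rewrite subr_ge0.
have p1 : 1 - q <= 1 by rewrite lerBlDr lerDl ltW.
have s0 : 0 <= 1 - q ^+ 2 by rewrite subr_ge0 exprn_ile1 // ltW.
apply: (@le_trans _ _ (\sum_(u < n | (0 < u)%N) (1 - q ^+ 2) ^+ (2 * b))).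
  apply: (avg_card_roots_sum (g := fun=> (1 - q ^+ 2) ^+ (2 * b))) => -[//|u] _.
  have pu0 := exprn_ge0 u p0; have pu1 := exprn_ile1 u p0 p1.
  have x1 : q <= 1 - (1 - q) ^+ u.+1.
    by rewrite exprS lerBrDr -lerBrDl ler_piMr.
  have x2 : 1 - (1 - q) ^+ u.+1 <= 1 by rewrite lerBlDr lerDl exprn_ge0.
  apply: lerXn2r; rewrite ?nnegrE //.
    by rewrite subr_ge0 mulr_ile1 // ?(ltW q0) // (le_trans (ltW q0)).
  by rewrite lerD2l lerN2 expr2 ler_wpM2l // ltW.
apply: (@le_trans _ _ (\sum_(u < n) (1 - q ^+ 2) ^+ (2 * b))).
  by rewrite big_mkcond /=; apply: ler_sum => u _; case: ifP => // _; rewrite exprn_ge0.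
by rewrite sumr_const card_ord mulr_natl.
Qed.

End RandomGraphRoots.

(** * A Chebyshev bound for indicators of distinct coordinates *)

Section Chebyshev.
Variables (R : realType) (E L I : finType) (V : {set I}) (iota : I -> E).
Variables (hit : I -> pred L) (a : R).
Hypotheses (L0 : (0 < #|L|)%N) (iota_inj : {in V &, injective iota}).
Hypothesis (hit_a : forall i, i \in V -> #|hit i|%:R / #|L|%:R = a).
Let nu := #|V|%:R * a.
Let x i (l : {ffun E -> L}) : R := (hit i (l (iota i)))%:R - a.

Let avg_x i : i \in V -> avg (x i) = 0.
Proof.
move=> iV; rewrite avgB avg_cst ?card_labels_gt0 //.
by rewrite (@avg_coord _ _ _ L0 _ (fun t => (hit i t)%:R)) avg_mem hit_a // subrr.
Qed.

Let avg_xx i : i \in V -> avg (fun l => x i l * x i l) <= a.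
Proof.
move=> iV; have a0 : 0 <= a by rewrite -(hit_a iV) divr_ge0.
(* Both values [1 - a] and [- a] of [x i] satisfy this identity, which is linear in [x i]; hence the
   variance is [a - a ^+ 2]. *)
rewrite (@eq_avg _ _ _ (fun l => (1 - 2 * a) * (x i l) + (a - a ^+ 2))).
  rewrite avgD avgZ avg_x // mulr0 add0r avg_cst ?card_labels_gt0 //.
  by rewrite lerBlDr lerDl sqr_ge0.
by move=> l; rewrite /x; case: (hit i _) => /=; ring.
Qed.

Let avg_xy i j : i \in V -> j \in V -> i != j -> avg (fun l => x i l * x j l) = 0.
Proof.
move=> iV jV ij; rewrite (@avg_indep _ _ _ L0 [set iota i]%SET) ?avg_x ?mul0r //.
- by move=> l l' ll'; rewrite /x ll' // inE.
- move=> l l' ll'; rewrite /x ll' // !inE; apply: contra ij => /eqP /iota_inj ->//.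
Qed.

Lemma avg_sum_le_chebyshev (K : nat) : K%:R < nu ->
  avg (fun l : {ffun E -> L} => ((\sum_(i in V) hit i (l (iota i)))%N <= K)%N%:R)
    <= nu / (nu - K%:R) ^+ 2.
Proof.
move=> Knu; have d0 : 0 < (nu - K%:R) ^+ 2 by rewrite exprn_gt0 // subr_gt0.
(* The double sum is the square of the deviation from the mean [nu]. On the event it is at least
   [(nu - K%:R) ^+ 2], and on average only its diagonal survives. *)
apply: (@le_trans _ _ (avg (fun l => (\sum_(i in V) \sum_(j in V) x i l * x j l) /
    (nu - K%:R) ^+ 2))).
  apply: avg_le => l.
  have -> : \sum_(i in V) \sum_(j in V) x i l * x j l =
     ((\sum_(i in V) hit i (l (iota i)))%N%:R - nu) ^+ 2.
    have -> : (\sum_(i in V) hit i (l (iota i)))%N%:R - nu = \sum_(i in V) x i l.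
      by rewrite sumrB sumr_const natr_sum /nu mulr_natl.
    by rewrite expr2 mulr_suml; apply: eq_bigr => i _; rewrite mulr_sumr.
  rewrite ler_pdivlMr //; case: leqP => [le|_]; last by rewrite mul0r sqr_ge0.
  rewrite mul1r -[leRHS]sqrrN opprB ler_sqr ?nnegrE.
  - by rewrite lerD2l lerN2 ler_nat.
  - by rewrite subr_ge0 ltW.
  - by rewrite subr_ge0 (le_trans _ (ltW Knu)) // ler_nat.
rewrite avgMr ler_wpM2r ?invr_ge0 ?(ltW d0) // avg_sum /nu mulr_natl -sumr_const.
apply: ler_sum => i iV; rewrite avg_sum (bigD1 i) //= big1 ?addr0 ?avg_xx //.
by move=> j /andP[jV ji]; rewrite avg_xy // eq_sym.
Qed.

End Chebyshev.

(** * The random construction *)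

Section Construction.
Variables (R : realType) (n k s m c : nat) (e0 : edge n).
Hypothesis m0 : (0 < m)%N.
Implicit Types (u v : 'I_n) (i j : 'I_k).

(** The colour [inl i] reserves an edge for tree [i]; [inr (_, b)] makes it a main edge with
    orientation bit [b]. The factor ['I_s] only adds weight to the main colours: with uniform
    colours a fraction [k / (k + 2 * s)] of the edges is reserved. *)
Definition colour := ('I_k + 'I_s * bool)%type.
Definition label := ('I_n * colour)%type.
Implicit Types (l : {ffun edge n -> label}) (x : label).

Definition level l (e : edge n) : nat := (l e).1.

Definition reserve_hit i (t : nat) : pred label :=
  fun x => (x.2 == inl i) && (x.1 < t)%N.

Definition reserve l i : {set edge n} := [set e | (l e).2 == inl i]%SET.

Definition main_hit (b : bool) : pred label :=
  fun x => (x.1 < c)%N && (if x.2 is inr (_, b') then b' == b else false).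

(* The bit of a main edge {u, v} orients it: from u to v when it is (u < v). *)
Definition arrow l u v : bool := main_hit (u < v)%N (l (edge_of e0 u v)).

Definition block (g : nat) : {set 'I_n} := [set v : 'I_n | (v %% m)%N == g]%SET.

Definition targets l u g : seq 'I_n := [seq v <- enum (block g) | arrow l u v].

(** Tree [i] belongs to block [i %% m] and uses there the target of rank [i %/ m]; the residue and
    the rank together recover [i]. *)
Definition forest_arrow l i u v : bool :=
  [&& v \in block (i %% m), u \notin block (i %% m), arrow l u v
    & index v (targets l u (i %% m)) == (i %/ m)%N].

Definition forest l i : {set edge n} :=
  [set e | [exists u, exists v, (e == edge_of e0 u v) && forest_arrow l i u v]]%SET.

Lemma forestP l i e : reflect (exists u v, e = edge_of e0 u v /\ forest_arrow l i u v)
  (e \in forest l i).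
Proof.
rewrite inE; apply: (iffP existsP) => [[u /existsP[v /andP[/eqP]]]|[u [v [E uv]]]].
  by exists u, v.
by exists u; apply/existsP; exists v; rewrite E eqxx.
Qed.

Lemma forest_arrow_neq l i u v : forest_arrow l i u v -> u != v.
Proof. by case/and4P=> vb ub _ _; apply: contraNneq ub => ->. Qed.

Lemma arrow_antisym l u v u' v' : u != v -> u' != v' -> arrow l u v -> arrow l u' v' ->
  edge_of e0 u v = edge_of e0 u' v' -> u = u' /\ v = v'.
Proof.
move=> uv uv' auv auv' E; have [//|[uE vE]] := edge_of_inj uv uv' E.
move: auv auv'; rewrite /arrow -E /main_hit uE vE.
case: (l _) => x [_|[_ b]] /=; rewrite ?andbF //.
case/andP=> _ /eqP -> /andP[_]; case: ltngtP => // /val_inj uvE.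
by rewrite uvE eqxx in uv'.
Qed.

(** The orientation bit recovers from the edge its tail [u] and head [v]; the residue of [v] gives
    [i %% m], and the rank of [v] among the targets of [u] gives [i %/ m]. *)
Lemma forest_disjoint l i j e : e \in forest l i -> e \in forest l j -> i = j.
Proof.
case/forestP=> u [v [E uv]] /forestP[u' [v' [E' uv']]].
have uNv := forest_arrow_neq uv; have uNv' := forest_arrow_neq uv'.
move: uv uv' => /and4P[vi _ auv iE] /and4P[vj _ auv' jE].
have [uu vv] := arrow_antisym uNv uNv' auv auv' (etrans (esym E) E').
subst u' v'; move: vi vj; rewrite !inE => /eqP vi /eqP vj.
rewrite -vi vj in iE; apply/val_inj; rewrite /= (divn_eq i m) (divn_eq j m).
by rewrite -(eqP iE) -(eqP jE) -vi vj.
Qed.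

Lemma forest_main l i e : e \in forest l i ->
  (level l e < c)%N /\ forall j, (l e).2 != inl j.
Proof.
case/forestP=> u [v [-> /and4P[_ _]]]; rewrite /arrow /main_hit /level.
by case: (l _) => x [?|[? ?]] /=; rewrite ?andbF // => /andP[].
Qed.

Lemma forest_reserve_disjoint l i j : i != j ->
  ((forest l i :|: reserve l i) :&: (forest l j :|: reserve l j))%SET = finset.set0.
Proof.
move=> ij; apply/finset.setP => e; rewrite finset.in_set0; apply/negbTE/negP.
rewrite finset.in_setI !finset.in_setU => /andP[].
have rP i' : e \in reserve l i' -> (l e).2 = inl i' by rewrite inE => /eqP.
case/orP=> ei; case/orP=> ej.
- by rewrite (forest_disjoint ei ej) eqxx in ij.
- by have [_ /(_ j)] := forest_main ei; rewrite (rP _ ej) eqxx.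
- by have [_ /(_ i)] := forest_main ej; rewrite (rP _ ei) eqxx.
- by move: ij; have := rP _ ei; rewrite (rP _ ej) => -[->]; rewrite eqxx.
Qed.

(** Ranks start at 0, so a target of rank [i %/ m] is missing exactly when the number of targets is
    at most [i %/ m]. *)
Definition starved l i u : bool :=
  (u \notin block (i %% m)) && (\sum_(v in block (i %% m)) arrow l u v <= i %/ m)%N.

(** A vertex outside the block that is not starved has an edge of the forest into the block, so the
    block and the starved vertices meet every component. *)
Lemma card_roots_forest l i :
  (#|roots (forest l i)| <= #|block (i %% m)| + \sum_u starved l i u)%N.
Proof.
pose S := (block (i %% m) :|: [set u | starved l i u])%SET.
apply: (@leq_trans #|S|); last first.
  apply: leq_trans (leq_card_setU _ _) _; rewrite leq_add2l -sum1_card big_mkcond /=.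
  by apply: leq_sum => u _; rewrite inE; case: (starved l i u).
apply: card_roots_cover => u.
have [uS|uS] := boolP (u \in S); first by exists u; rewrite ?connect0.
move: uS; rewrite finset.in_setU negb_or => /andP[ub]; rewrite inE /starved ub /= -ltnNge.
have -> : (\sum_(v in block (i %% m)) arrow l u v)%N = size (targets l u (i %% m)).
  rewrite size_filter -sum1_count [RHS]big_mkcond big_enum.
  by apply: eq_bigr => v _; case: arrow.
move=> lt; pose v := nth u (targets l u (i %% m)) (i %/ m).
have /mem_nth vt := lt; move: (vt u); rewrite -/v mem_filter mem_enum => /andP[auv vb].
exists v; first by rewrite finset.in_setU vb.
have uv : forest_arrow l i u v.
  by rewrite /forest_arrow vb ub auv /= index_uniq // filter_uniq // enum_uniq.
apply/connect1/(@adjacent_mem _ _ (edge_of e0 u v)).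
  by apply/forestP; exists u, v.
exact/val_edge_of/(forest_arrow_neq uv).
Qed.

Lemma sum_forest_le l :
  (\sum_(i < k) \sum_(e in forest l i) (level l e).+1 <=
   \sum_e if level l e < c then (level l e).+1 else 0)%N.
Proof.
rewrite (exchange_big_dep xpredT) //=; apply: leq_sum => e _.
case: (pickP (fun i => e \in forest l i)) => [i ei|none]; last by rewrite big_pred0.
rewrite (bigD1 i) //= (forest_main ei).1 big_pred0 ?addn0 // => j.
by apply/negbTE/negP => /andP[/(forest_disjoint ei) ->]; rewrite eqxx.
Qed.

Lemma reserve_below l i t :
  [set e in reserve l i | (level l e < t)%N]%SET = random_graph (reserve_hit i t) l.
Proof. by apply/finset.setP => e; rewrite !inE. Qed.

Lemma reserve_all l i : reserve l i = random_graph (reserve_hit i n) l.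
Proof. by apply/finset.setP => e; rewrite !inE /reserve_hit ltn_ord andbT. Qed.

Lemma card_label : #|{: label}| = (n * (k + s * 2))%N.
Proof. by rewrite card_prod card_sum card_prod !card_ord card_bool. Qed.

Lemma card_ord_lt t : (t <= n)%N -> #|[pred x : 'I_n | (x < t)%N]| = t.
Proof.
move=> tn; rewrite cardE -[RHS](size_iota 0) -(size_map val); apply/perm_size.
apply: uniq_perm; rewrite ?iota_uniq ?(map_inj_uniq val_inj) ?enum_uniq //.
move=> y; rewrite mem_iota add0n /=; apply/mapP/idP => [[x]|yt].
  by rewrite mem_enum => xt ->.
by exists (Ordinal (leq_trans yt tn)); rewrite ?mem_enum.
Qed.

Lemma card_reserve_hit i t : (t <= n)%N -> #|reserve_hit i t| = t.
Proof.
move=> tn; rewrite -[RHS]muln1 -(card1 (inl i : colour)) -[in RHS](card_ord_lt tn).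
by rewrite -cardX; apply: eq_card => -[x y]; rewrite !inE unfold_in andbC.
Qed.

Lemma card_main_hit b : (c <= n)%N -> #|main_hit b| = (c * s)%N.
Proof.
move=> cn; pose f (y : 'I_s) : colour := inr (y, b).
have f_inj : injective f by move=> y z [].
rewrite -[in RHS](card_ord s) -(card_codom f_inj) -[in RHS](card_ord_lt cn) -cardX.
apply: eq_card => -[x y]; rewrite !inE unfold_in /=; congr (_ && _).
case: y => [y|[y b']]; first by apply/esym/negbTE/codomP => -[].
by apply/eqP/codomP => [->|[z [_ ->]]//]; exists y.
Qed.

End Construction.

(** * Expected costs of the random construction *)

Section ConstructionCost.
Variables (R : realType) (n k s : nat) (e0 : edge n).
Hypotheses (k0 : (0 < k)%N) (n0 : (0 < n)%N).
Implicit Types (u v : 'I_n) (i : 'I_k) (l : {ffun edge n -> label n k s}).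

Let N : R := n%:R * (k + s * 2)%:R.

Lemma card_label_gt0 : (0 < #|{: label n k s}|)%N.
Proof. by rewrite card_label muln_gt0 n0 addn_gt0 k0. Qed.
Let L0 := card_label_gt0.

Let nr : 0 < n%:R :> R. Proof. by rewrite ltr0n. Qed.
Let cr : 0 < (k + s * 2)%:R :> R. Proof. by rewrite ltr0n addn_gt0 k0. Qed.

Lemma card_edges_le : (#|{: edge n}|%:R : R) <= n%:R ^+ 2 / 2.
Proof.
rewrite ler_pdivlMr // -natrM (card_edges n) natrM expr2 ler_wpM2l // ler_nat.
exact: leq_pred.
Qed.

(** The density is [q = t / (n * (k + 2 * s))], and [n %/ 4 >= n / 8]. The two terms of
    [avg_card_roots] then carry the constants 16 and 256, which add up to 272. *)
Lemma avg_reserve_roots i (t : nat) : (0 < t)%N -> (t <= n)%N -> (8 <= n)%N ->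
  avg (fun l => #|roots [set e in reserve l i | (level l e < t)%N]%SET|%:R) <=
    272 * n%:R * (k + s * 2)%:R ^+ 2 / t%:R ^+ 2 :> R.
Proof.
move=> t0 tn n8; under eq_avg do rewrite reserve_below.
have tr : 0 < t%:R :> R by rewrite ltr0n.
pose q : R := #|@reserve_hit n k s i t|%:R / #|{: label n k s}|%:R.
have qE : q = t%:R / N by rewrite /q card_reserve_hit // card_label natrM.
have N0 : 0 < N by rewrite mulr_gt0.
have q0 : 0 < q by rewrite qE divr_gt0.
pose d := (n %/ 4)%N; have d0 : (0 < d)%N by rewrite divn_gt0 //; lia.
have dn : (4 * d <= n)%N by rewrite mulnC leq_trunc_div.
have nd : n%:R / 8 <= d%:R :> R.
  rewrite ler_pdivrMr // -natrM ler_nat /d; lia.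
have dr : 0 < d%:R :> R by rewrite ltr0n.
apply: le_trans (avg_card_roots e0 L0 d0 dn q0) _; rewrite -/q; clearbody q.
have n8r : 0 < n%:R / 8 :> R by rewrite divr_gt0.
apply: le_trans (_ : 2 / (n%:R / 8 * q ^+ 2) + 4 * n%:R / (n%:R / 8 * q) ^+ 2 <= _).
  have q2 : 0 < q ^+ 2 by rewrite exprn_gt0.
  apply: lerD.
    rewrite ler_wpM2l // lef_pV2 ?posrE ?mulr_gt0 //.
    by rewrite ler_wpM2r // ltW.
  rewrite ler_wpM2l ?mulr_ge0 // lef_pV2 ?posrE ?exprn_gt0 ?mulr_gt0 //.
  apply: lerXn2r; rewrite ?nnegrE ?mulr_ge0 ?(ltW q0) ?(ltW n8r) //.
  by rewrite ler_wpM2r // ltW.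
rewrite qE /N le_eqVlt; apply/orP; left; apply/eqP; field.
by rewrite !gt_eqF // -natrM -natrD.
Qed.

(** Here [q = 1 / (k + 2 * s)]. The exponent is cut into four parts of length [n %/ 8 >= n / 16],
    each bounded by [expr_bernoulli]; the fourth power outweighs the factor [n] and the quadratic
    number of edges. *)
Lemma avg_reserve_disconnected i : (8 <= n)%N ->
  avg (fun l => #|roots (reserve l i)|%:R) <=
    n%:R * (16 * (k + s * 2)%:R ^+ 2 / n%:R) ^+ 4 :> R.
Proof.
move=> n8; under eq_avg do rewrite reserve_all.
pose q : R := #|@reserve_hit n k s i n|%:R / #|{: label n k s}|%:R.
have qE : q = (k + s * 2)%:R^-1.
  rewrite /q card_reserve_hit // card_label natrM.
  by field; rewrite !gt_eqF // -natrM -natrD.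
have q0 : 0 < q by rewrite qE invr_gt0.
have q1 : q <= 1 by rewrite qE invf_le1 // ler1n addn_gt0 k0.
pose d := (n %/ 4)%N; have d0 : (0 < d)%N by rewrite divn_gt0 //; lia.
have dn : (4 * d <= n)%N by rewrite mulnC leq_trunc_div.
apply: le_trans (avg_card_roots_exp e0 L0 dn q0) _; rewrite -/q; clearbody q.
rewrite ler_wpM2l //; pose d' := (n %/ 8)%N.
have dd : (d' * 4 <= 2 * d)%N by rewrite /d' /d; lia.
have s0 : 0 <= 1 - q ^+ 2 by rewrite subr_ge0 exprn_ile1 // ltW.
have s1 : 1 - q ^+ 2 <= 1 by rewrite lerBlDr lerDl sqr_ge0.
apply: le_trans (ler_wiXn2l s0 s1 dd) _; rewrite exprM.
apply: lerXn2r; rewrite ?nnegrE ?exprn_ge0 //.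
have q2 : 0 < q ^+ 2 by rewrite exprn_gt0.
have q01 : 0 <= q ^+ 2 <= 1 by rewrite (ltW q2) exprn_ile1 // ltW.
apply: le_trans (expr_bernoulli _ q01) _.
have -> : 16 * (k + s * 2)%:R ^+ 2 / n%:R = (n%:R / 16 * q ^+ 2)^-1.
  by rewrite qE; field; rewrite !gt_eqF // -natrM -natrD.
have nd : n%:R / 16 <= d'%:R :> R by rewrite ler_pdivrMr // -natrM ler_nat /d'; lia.
have p1 : 0 < n%:R / 16 * q ^+ 2 by rewrite mulr_gt0 // divr_gt0.
have p2 : n%:R / 16 * q ^+ 2 <= 1 + d'%:R * q ^+ 2.
  by rewrite -[leLHS]add0r lerD // ler_wpM2r // ltW.
by rewrite lef_pV2 ?posrE // (lt_le_trans p1).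
Qed.

Variables (m c : nat).
Hypotheses (m0 : (0 < m)%N) (cn : (c <= n)%N).

Lemma sum_level_le (a d : nat) :
  (2 * (\sum_(y < a) if y < d then y.+1 else 0) <= d * d.+1)%N.
Proof.
suff : (2 * (\sum_(y < a) if y < d then y.+1 else 0) <= minn a d * (minn a d).+1)%N.
  by move=> /leq_trans; apply; rewrite leq_mul // ?ltnS geq_minr.
elim: a => [|a IH]; first by rewrite big_ord0.
rewrite big_ord_recr /= mulnDr; case: ltnP => ad; last first.
  rewrite muln0 addn0; apply: leq_trans IH _.
  by rewrite !(minn_idPr _) ?leqnn // leqW.
rewrite (minn_idPl ad); rewrite (minn_idPl (ltnW ad)) in IH.
by apply: leq_trans (leq_add IH (leqnn _)) _; rewrite -mulnDl addn2 mulnC.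
Qed.

(** There are at most [n ^ 2 / 2] edges, and each costs on average at most
    [c * (c + 1) / (2 * n)]. *)
Lemma avg_main : avg (fun l =>
    (\sum_e if (level l e < c)%N then (level l e).+1 else 0)%N%:R) <=
  n%:R * (c * c.+1)%:R / 4 :> R.
Proof.
under eq_avg do rewrite natr_sum.
rewrite avg_sum.
pose f (y : 'I_n) : R := (if (y < c)%N then y.+1 else 0)%N%:R.
rewrite (eq_bigr (fun=> avg f)) => [|e _]; last first.
  rewrite (@avg_coord _ _ _ L0 e (fun x : label n k s => f x.1)) avg_prod_type.
  apply: eq_avg => y /=; rewrite avg_cst // card_sum card_ord addn_gt0 k0 //.
rewrite sumr_const -(mulr_natl (avg f)).
have favg : avg f <= (c * c.+1)%:R / 2 / n%:R.
  rewrite /avg card_ord ler_wpM2r ?invr_ge0 // ler_pdivlMr // -natr_sum -natrM.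
  by rewrite ler_nat mulnC sum_level_le.
apply: (@le_trans _ _ (n%:R ^+ 2 / 2 * ((c * c.+1)%:R / 2 / n%:R))).
  apply: ler_pM => //; last exact: card_edges_le.
  by apply: avg_ge0 => y; rewrite /f ler0n.
by rewrite le_eqVlt; apply/orP; left; apply/eqP; field; rewrite gt_eqF.
Qed.

(** The expected number [nu] of light edges from [u] into the block satisfies
    [nu - K >= nu / (r + 1)], so Chebyshev's bound is at most [(r + 1) ^ 2 / nu], and [nu >= K]. *)
Lemma avg_starved i u (K r : nat) : (0 < K)%N -> (i %/ m <= K)%N -> (0 < r)%N ->
  (K * r.+1)%:R <= #|block n m (i %% m)|%:R * ((c * s)%:R / N) * r%:R ->
  avg (fun l => (starved m c e0 l i u)%:R) <= r.+1%:R ^+ 2 / K%:R :> R.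
Proof.
move=> K0 iK r0 Knu; set V := block n m (i %% m) in Knu *.
have Kr : 0 < K%:R :> R by rewrite ltr0n.
have rr : 0 < r%:R :> R by rewrite ltr0n.
have [uV|uV] := boolP (u \in V).
  rewrite /avg big1 => [|l _]; last by rewrite /starved uV.
  by rewrite mul0r divr_ge0 // exprn_ge0.
set nu := #|V|%:R * _ in Knu.
have nuK : nu - K%:R >= nu / r.+1%:R.
  rewrite ler_pdivrMr ?ltr0n // -natr1; rewrite natrM -natr1 in Knu; lra.
have nu0 : 0 < nu.
  rewrite -(pmulr_lgt0 _ rr); apply: lt_le_trans Knu; by rewrite ltr0n muln_gt0 K0.
have Klt : K%:R < nu.
  by rewrite -subr_gt0; apply: lt_le_trans nuK; rewrite divr_gt0 // ltr0n.
pose hit v : pred (label n k s) := main_hit c (u < v)%N.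
have inj : {in V &, injective (edge_of e0 u)}.
  move=> v w vV wV; apply: edge_of_injr; rewrite inE.
    by apply: contraNneq uV => <-.
  by apply: contraNneq uV => <-.
have hit_a v : v \in V -> #|hit v|%:R / #|{: label n k s}|%:R = (c * s)%:R / N :> R.
  by move=> _; rewrite card_main_hit // card_label /N -[in RHS]natrM.
apply: le_trans (_ : nu / (nu - K%:R) ^+ 2 <= _).
  apply: le_trans (avg_sum_le_chebyshev L0 inj hit_a Klt).
  apply: avg_le => l; rewrite ler_nat /starved uV /=.
  by case: (leqP _ (i %/ m)%N) => // le; rewrite (leq_trans le iK).
have dpos : 0 < nu / r.+1%:R by rewrite divr_gt0 // ltr0n.
apply: le_trans (_ : nu / (nu / r.+1%:R) ^+ 2 <= _).
  rewrite ler_wpM2l ?(ltW nu0) // lef_pV2 ?posrE ?exprn_gt0 ?subr_gt0 //.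
  by apply: lerXn2r; rewrite ?nnegrE ?(ltW dpos) // subr_ge0 ltW.
have -> : nu / (nu / r.+1%:R) ^+ 2 = r.+1%:R ^+ 2 / nu.
  have : 0 < r.+1%:R :> R by rewrite ltr0n.
  by move: r.+1%:R => y y0; field; rewrite !gt_eqF.
by rewrite ler_wpM2l ?exprn_ge0 // lef_pV2 ?posrE // ltW.
Qed.

End ConstructionCost.

Lemma card_block_le (R : realType) (n m g : nat) : (0 < m)%N ->
  #|block n m g|%:R <= n%:R / m%:R + 1 :> R.
Proof.
move=> m0; have mr : 0 < m%:R :> R by rewrite ltr0n.
have le : (#|block n m g| <= (n %/ m).+1)%N.
  pose f (v : 'I_n) : 'I_(n %/ m).+1 := inord (v %/ m).
  rewrite -[leqRHS]card_ord -(card_in_imset (f := f)); first exact: max_card.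
  move=> u v; rewrite !inE => /eqP ug /eqP vg /(congr1 val).
  rewrite /= !inordK ?ltnS ?leq_div2r ?(ltnW (ltn_ord _)) // => uv.
  by apply/val_inj; rewrite /= (divn_eq u m) (divn_eq v m) ug vg uv.
apply: (@le_trans _ _ (n %/ m).+1%:R); first by rewrite ler_nat.
rewrite -natr1 lerD2r ler_pdivlMr // -natrM ler_nat; exact: leq_trunc_div.
Qed.

Lemma card_block_ge (R : realType) (n m g : nat) : (g < m)%N ->
  n%:R / m%:R - 1 <= #|block n m g|%:R :> R.
Proof.
move=> gm; have m0 : (0 < m)%N by apply: leq_ltn_trans gm.
have mr : 0 < m%:R :> R by rewrite ltr0n.
have le : (n %/ m <= #|block n m g|)%N.
  have lt (j : 'I_(n %/ m)) : (j * m + g < n)%N.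
    apply: (@leq_trans (j.+1 * m)); first by rewrite mulSn addnC ltn_add2r.
    by apply: leq_trans (leq_trunc_div n m); rewrite leq_mul2r ltn_ord orbT.
  pose f j : 'I_n := Ordinal (lt j).
  have f_inj : injective f.
    by move=> i j /(congr1 val) /= /addIn /eqP; rewrite eqn_pmul2r // => /eqP /val_inj.
  rewrite -[leqLHS]card_ord -(card_codom f_inj); apply/subset_leq_card/fintype.subsetP.
  by move=> v /codomP[j ->]; rewrite inE /= modnMDl modn_small.
apply: (@le_trans _ _ (n %/ m)%:R); last by rewrite ler_nat.
rewrite lerBlDr natr1 ler_pdivrMr // -natrM ler_nat mulSn addnC.
by rewrite [leqLHS](divn_eq n m) leq_add2l ltnW // ltn_pmod.
Qed.

(** * Bounds on the expected minimum for fixed [n] and [k] *)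

Section MstBounds.
Context {R : realType} {d : measure_display} {T : measurableType d}.
Variables (P : probability T R) (n k : nat) (X : edge n -> {RV P >-> R}).
Hypotheses (n2 : (2 <= n)%N) (k0 : (0 < k)%N).
Hypothesis uX : forall e, uniform01 (X e).
Hypothesis iX : mutually_independent X.

Let n0 : (0 < n)%N. Proof. exact: ltnW. Qed.
Let nr : 0 < n%:R :> R. Proof. by rewrite ltr0n. Qed.

Let in_cell_level (l : {ffun edge n -> 'I_n}) w e : in_cells X l w ->
  (l e)%:R / n%:R <= X e w <= (l e).+1%:R / n%:R.
Proof. by move=> /(_ e); rewrite /cell /= in_itv /= => /andP[/ltW -> ->]. Qed.

Let min_weight_ge0_cells (l : {ffun edge n -> 'I_n}) w : in_cells X l w ->
  (0 <= min_weight k (fun e => X e w))%E.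
Proof.
move=> lw; apply: min_weight_ge0 => e; have /andP[+ _] := in_cell_level e lw.
by apply: le_trans; rewrite divr_ge0.
Qed.

Lemma mst_ge : (((n.-1)%:R / n%:R * (k%:R ^+ 2 - k%:R / 2) : R)%:E <= mst k X)%E.
Proof.
(* The bound obtained is, to leading order, [c * k - c ^ 2 / 4], which is largest at [c = 2 * k]. *)
pose c := (2 * k)%N.
pose G (l : {ffun edge n -> 'I_n}) : R :=
  ((c * (k * n.-1))%:R - (\sum_e (c - l e))%N%:R) / n%:R.
apply: (@le_trans _ _ (avg G)%:E); last first.
  apply: (integral_ge_avg n0 uX iX); first exact: measurable_min_weight.
  move=> l w lw; split; first exact: min_weight_ge0_cells lw.
  apply: (min_weight_ge _ _ (lev := fun e => l e)) => // e.
  by case/andP: (in_cell_level e lw).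
have I0 : (0 < #|'I_n|)%N by rewrite card_ord.
rewrite lee_fin /G avgMr avgB avg_cst ?card_labels_gt0 //.
rewrite (@eq_avg _ _ _ (fun l : {ffun edge n -> 'I_n} => \sum_e (c - l e)%N%:R)); last first.
  by move=> l; rewrite natr_sum.
rewrite avg_sum (eq_bigr (fun=> avg (fun y : 'I_n => (c - y)%N%:R))) => [|e _]; last first.
  exact: (avg_coord I0 e (fun y : 'I_n => (c - y)%N%:R)).
rewrite sumr_const -(mulr_natl (avg _)).
have sum_le (a b : nat) : (2 * (\sum_(y < a) (b - y)) <= b * b.+1)%N.
  elim: a b => [|a IH] b; first by rewrite big_ord0.
  rewrite big_ord_recl subn0 /=; case: b => [|b]; first by rewrite big1.
  rewrite (eq_bigr (fun y : 'I_a => b - y)%N) => [|y _]; last by rewrite /bump /= add1n subSS.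
  rewrite mulnDr; apply: leq_trans (leq_add (leqnn _) (IH b)) _; lia.
have avg_le : avg (fun y : 'I_n => (c - y)%N%:R) <= (c * c.+1)%:R / 2 / n%:R :> R.
  rewrite /avg card_ord ler_wpM2r ?invr_ge0 // ler_pdivlMr // -natr_sum -natrM.
  by rewrite ler_nat mulnC sum_le.
have edges : #|{: edge n}|%:R = n%:R * n.-1%:R / 2 :> R.
  have /(congr1 (fun y => y%:R : R)) := card_edges n; rewrite !natrM => E.
  by apply: (@mulIf _ 2) => //; rewrite mulfVK.
rewrite edges ler_pdivlMr //.
have E0 : 0 <= n%:R * n.-1%:R / 2 :> R by rewrite divr_ge0 // mulr_ge0.
have := ler_wpM2l E0 avg_le; set a := avg _ => le_a.
have -> : n.-1%:R / n%:R * (k%:R ^+ 2 - k%:R / 2) * n%:R =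
  (c * (k * n.-1))%:R - n%:R * n.-1%:R / 2 * ((c * c.+1)%:R / 2 / n%:R) :> R.
  rewrite /c -natr1 !natrM; field; rewrite gt_eqF //.
by rewrite lerD2l lerN2.
Qed.

(** This passes from a bound valid for every colouring to the average over the colourings; the
    minimum weight is extended-real, and one finite bound already excludes [+oo]. *)
Lemma le_avg_ereal (I : finType) (z : \bar R) (f : I -> R) : (0 < #|I|)%N ->
  (0 <= z)%E -> (forall i, (z <= (f i)%:E)%E) -> (z <= (avg f)%:E)%E.
Proof.
move=> I0; case: z => [z| |] // _ zf.
  rewrite lee_fin -(avg_cst z I0); apply: avg_le => i.
  by have := zf i; rewrite lee_fin.
by case/card_gt0P: I0 => i _; have := zf i.
Qed.

Variables (s m c t J K r : nat).
Hypotheses (m0 : (0 < m)%N) (cn : (c <= n)%N) (t0 : (0 < t)%N) (n8 : (8 <= n)%N).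
Hypotheses (K0 : (0 < K)%N) (r0 : (0 < r)%N) (kK : (k %/ m <= K)%N).
Hypotheses (tJn : (n <= t * 2 ^ J)%N) (tjn : forall j, (j < J)%N -> (t * 2 ^ j <= n)%N).
Let W : R := (k + s * 2)%:R.
Hypothesis starved_bound :
  K%:R * r.+1%:R <= (n%:R / m%:R - 1) * ((c * s)%:R / (n%:R * W)) * r%:R :> R.

Local Notation forest := (forest m c).

Let e0_card : #|[set Ordinal n0; Ordinal n2]%SET| == 2%N. Proof. by rewrite cards2. Qed.
Let e0 : edge n := Sub [set Ordinal n0; Ordinal n2]%SET e0_card.

Let L0 := card_label_gt0 s k0 n0.

(** Stage [j] pays [t * 2 ^ j.+1] per root, hence at most [544 * n * W ^ 2 / (t * 2 ^ j)] on
    average; the geometric sum doubles the constant to 1088. *)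
Lemma avg_completion_cost :
  avg (fun l : {ffun edge n -> label n k s} =>
    (completion_cost (forest e0 l) (reserve l) (level l) t J)%:R) <=
  n%:R * (c * c.+1)%:R / 4 +
  k%:R * (t%:R * (n%:R / m%:R + 1 + n%:R * (r.+1%:R ^+ 2 / K%:R)) +
    1088 * n%:R * W ^+ 2 / t%:R) :> R.
Proof.
have tr : 0 < t%:R :> R by rewrite ltr0n.
apply: (@le_trans _ _ (avg (fun l : {ffun edge n -> label n k s} =>
   (\sum_e if (level l e < c)%N then (level l e).+1 else 0)%N%:R +
   \sum_(i < k) (t%:R * (#|block n m (i %% m)|%:R + \sum_u (starved m c e0 l i u)%:R) +
    \sum_(j < J) (t * 2 ^ j.+1)%:R *
      #|roots [set e in reserve l i | (level l e < t * 2 ^ j)%N]%SET|%:R)))).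
  apply: avg_le => l.
  have -> : completion_cost (forest e0 l) (reserve l) (level l) t J =
    (\sum_(i < k) \sum_(e in forest e0 l i) (level l e).+1 +
     \sum_(i < k) (t * #|roots (forest e0 l i)| + \sum_(j < J) t * 2 ^ j.+1 *
       #|roots [set e in reserve l i | (level l e < t * 2 ^ j)%N]%SET|))%N.
    by rewrite -big_split; apply: eq_bigr => i _; rewrite /= addnA.
  rewrite natrD; apply: lerD; first by rewrite ler_nat; apply: sum_forest_le.
  rewrite natr_sum; apply: ler_sum => i _; rewrite natrD; apply: lerD.
    rewrite natrM ler_wpM2l // -natr_sum -natrD ler_nat; exact: card_roots_forest.
  by rewrite natr_sum; apply: ler_sum => j _; rewrite natrM.
rewrite avgD; apply: lerD; first exact: avg_main.
rewrite avg_sum -[k in leRHS]card_ord mulr_natl -sumr_const; apply: ler_sum => i _.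
rewrite avgD avgZ avgD avg_cst ?card_labels_gt0 // !avg_sum; apply: lerD.
  rewrite ler_wpM2l //; apply: lerD; first exact: card_block_le.
  rewrite -[n in leRHS]card_ord mulr_natl -sumr_const; apply: ler_sum => u _.
  apply: avg_starved => //; first by apply: leq_trans kK; rewrite leq_div2r // ltnW.
  rewrite natrM; apply: le_trans starved_bound _.
  rewrite ler_wpM2r // ler_wpM2r ?divr_ge0 ?mulr_ge0 //.
  by apply: card_block_ge; rewrite ltn_pmod.
have term j : (j < J)%N -> avg (fun l : {ffun edge n -> label n k s} =>
     (t * 2 ^ j.+1)%:R * #|roots [set e in reserve l i | (level l e < t * 2 ^ j)%N]%SET|%:R)
   <= 544 * n%:R * W ^+ 2 / t%:R * 2^-1 ^+ j :> R.
  move=> jJ; rewrite avgZ.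
  have tj0 : (0 < t * 2 ^ j)%N by rewrite muln_gt0 t0 expn_gt0.
  apply: le_trans (ler_wpM2l _ (avg_reserve_roots R s e0 k0 n0 i tj0 (tjn jJ) n8)) _ => //.
  rewrite le_eqVlt; apply/orP; left; apply/eqP; rewrite -/W expnS mulnCA !natrM natrX exprVn.
  have : (2 ^+ j : R) != 0 by rewrite expf_neq0.
  by move: (2 ^+ j : R) => y y0; field; rewrite y0 gt_eqF.
apply: le_trans (ler_sum _ (fun (j : 'I_J) _ => term j (ltn_ord j))) _.
rewrite -mulr_sumr.
have geo : \sum_(j < J) 2^-1 ^+ j <= 2 :> R.
  suff -> : \sum_(j < J) 2^-1 ^+ j = 2 - 2 * 2^-1 ^+ J :> R.
    by rewrite lerBlDr lerDl mulr_ge0 // exprn_ge0.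
  elim: (J) => [|a IH]; first by rewrite big_ord0 expr0; ring.
  by rewrite big_ord_recr /= IH exprS; field.
apply: le_trans (ler_wpM2l _ geo) _.
  have W2 : 0 <= W ^+ 2 := exprn_ge0 2 (ler0n R _).
  exact: divr_ge0 (mulr_ge0 (mulr_ge0 (ler0n R 544) (ltW nr)) W2) (ltW tr).
by rewrite le_eqVlt; apply/orP; left; apply/eqP; field; rewrite gt_eqF.
Qed.

Hypothesis connected_reserves : k%:R * (n%:R * (16 * W ^+ 2 / n%:R) ^+ 4) < 1.

Lemma avg_disconnected :
  avg (fun l : {ffun edge n -> label n k s} => (\sum_(i < k) #|roots (reserve l i)|)%N%:R)
  <= k%:R * (n%:R * (16 * W ^+ 2 / n%:R) ^+ 4).
Proof.
rewrite (@eq_avg _ _ _ (fun l : {ffun edge n -> label n k s} =>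
  \sum_(i < k) #|roots (reserve l i)|%:R)) => [|l]; last by rewrite natr_sum.
rewrite avg_sum -[k in leRHS]card_ord mulr_natl -sumr_const; apply: ler_sum => i _.
exact: avg_reserve_disconnected.
Qed.

(** The expected total number of roots of the reserves is below 1, so in some labelling all of them
    are connected. *)
Lemma disjoint_spanning_trees_exist_large :
  exists F : {ffun 'I_k -> {set edge n}}, disjoint_spanning_trees F.
Proof.
have [l] := avg_lt_exists (card_labels_gt0 _ L0)
  (le_lt_trans avg_disconnected connected_reserves).
rewrite -[1]/(1%:R) ltr_nat ltnS leqn0 sum_nat_eq0 => /forallP l0.
apply: (@disjoint_spanning_trees_exist _ _ (reserve l)) => [i j ij|i].
  apply/eqP; rewrite -finset.subset0 -(forest_reserve_disjoint m c e0 l ij).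
  by apply: finset.setISS; apply: finset.subsetUr.
by apply/eqP; rewrite -cards_eq0; have := l0 i.
Qed.

Lemma mst_le : (mst k X <= ((c * c.+1)%:R / 4 +
    k%:R * (t%:R * (m%:R^-1 + n%:R^-1 + r.+1%:R ^+ 2 / K%:R) + 1088 * W ^+ 2 / t%:R) +
    k%:R ^+ 2 * n%:R ^+ 3 * (16 * W ^+ 2 / n%:R) ^+ 4)%:E)%E.
Proof.
(* If some reserve is disconnected, the number of roots is at least 1 and the second summand alone
   covers the crude bound; otherwise the first summand suffices. *)
pose cost (l : {ffun edge n -> label n k s}) : R :=
  (completion_cost (forest e0 l) (reserve l) (level l) t J)%:R / n%:R +
  (\sum_(i < k) #|roots (reserve l i)|)%N%:R * (k * #|{: edge n}|)%:R.
have cost0 l : 0 <= cost l by rewrite addr_ge0 ?divr_ge0 ?mulr_ge0.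
pose mark (a : {ffun edge n -> 'I_n}) (b : {ffun edge n -> colour k s}) :
  {ffun edge n -> label n k s} := [ffun e => (a e, b e)].
have C0 : (0 < #|{: colour k s}|)%N by rewrite card_sum card_ord addn_gt0 k0.
pose G a : R := avg (fun b => cost (mark a b)).
apply: (@le_trans _ _ (avg G)%:E).
  apply: (integral_le_avg n0 uX iX); first exact: measurable_min_weight.
    by move=> a; apply: avg_ge0.
  move=> a w aw; rewrite (min_weight_ge0_cells aw) /=.
  apply: le_avg_ereal; [exact: card_labels_gt0|exact: min_weight_ge0_cells aw|move=> b].
  have lev e : level (mark a b) e = a e by rewrite /level ffunE.
  have [conn|/existsNP[i /eqP disc]] :=
    pselect (forall i, roots (reserve (mark a b) i) = finset.set0).
    apply: le_trans (@min_weight_le_completion _ _ _ (forest e0 (mark a b)) _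
      (level (mark a b)) t J n _ _ _ conn _) _.
    - by move=> i j; apply: forest_reserve_disjoint.
    - by move=> i e _; apply: leq_trans tJn; rewrite lev.
    - by move=> e; rewrite lev; case/andP: (in_cell_level e aw).
    - by rewrite lee_fin lerDl mulr_ge0.
  have [F FP] := disjoint_spanning_trees_exist_large.
  apply: le_trans (min_weight_le_card FP _) _.
    move=> e; have /andP[a1 a2] := in_cell_level e aw; apply/andP; split.
      by apply: le_trans a1; rewrite divr_ge0.
    by apply: le_trans a2 _; rewrite ler_pdivrMr // mul1r ler_nat.
  rewrite lee_fin -[leLHS]add0r lerD ?divr_ge0 // -[leLHS]mul1r ler_wpM2r //.
  rewrite -[1]/(1%:R) ler_nat; apply: leq_trans (_ : #|roots (reserve (mark a b) i)| <= _)%N.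
    by rewrite lt0n cards_eq0.
  by rewrite (bigD1 i) //= leq_addr.
rewrite /G avg_ffun_pair lee_fin avgD; apply: lerD.
  rewrite avgMr ler_pdivrMr //; apply: le_trans avg_completion_cost _.
  rewrite le_eqVlt; apply/orP; left; apply/eqP.
  field; rewrite !gt_eqF ?ltr0n //.
rewrite avgMr; apply: le_trans (ler_wpM2r _ avg_disconnected) _ => //.
have edges : (k * #|{: edge n}|)%:R <= k%:R * n%:R ^+ 2 :> R.
  rewrite natrM ler_wpM2l //; apply: le_trans (card_edges_le R n) _.
  by rewrite ler_pdivrMr // ler_peMr ?exprn_ge0 // ler1n.
apply: le_trans (ler_wpM2l _ edges) _.
  by rewrite !mulr_ge0 // exprn_ge0 // divr_ge0 // mulr_ge0 // exprn_ge0.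
by rewrite le_eqVlt; apply/orP; left; apply/eqP; ring.
Qed.

End MstBounds.

(** * Asymptotics *)

Section Asymptotics.
Variable R : realType.

(** The accuracy [r] fixes the number of blocks; the threshold [k0] absorbs the terms linear in [k],
    and [n0] those that vanish as [n] grows. *)
Lemma mst_eventually_le (r : nat) : (0 < r)%N ->
  exists k0 : nat, forall k : nat, (k0 <= k)%N -> exists n0 : nat,
  forall (n : nat) (d : measure_display) (T : measurableType d) (P : probability T R)
    (X : edge n -> {RV P >-> R}), (n0 <= n)%N ->
  (forall e, uniform01 (X e)) -> mutually_independent X ->
  (mst k X <= (k%:R ^+ 2 * (1 + 23 / r%:R))%:E)%E.
Proof.
have sum_lt (a1 a2 a3 a4 a5 x : nat) : (a1 + a2 + a3 + a4 + a5 < x)%N ->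
    [/\ (a1 < x)%N, (a2 < x)%N, (a3 < x)%N, (a4 < x)%N & (a5 < x)%N].
  by split; lia.
move=> r0; have rr : 0 < r%:R :> R by rewrite ltr0n.
have r1 : 1 <= r%:R :> R by rewrite ler1n.
(* The parameters balance the losses: with t = k * sg, completing the forests
   costs t * k / m for the blocks and 1088 * k * (k + 2 * s) ^ 2 / t for the dyadic
   levels, and both equal k ^ 2 / r. *)
have [sg sg0 sgE] : exists2 sg, (0 < sg)%N &
    sg%:R = 1088 * r%:R * (1 + 2 * r%:R) ^+ 2 :> R.
  exists (1088 * (r * ((1 + 2 * r) * (1 + 2 * r))))%N; first by rewrite !muln_gt0 r0.
  by rewrite !(natrM, natrD); ring.
pose m := (r * sg)%N.
have m0 : (0 < m)%N by rewrite muln_gt0 r0.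
have mr : 0 < m%:R :> R by rewrite ltr0n.
have sgr : 0 < sg%:R :> R by rewrite ltr0n.
pose al : R := (2 + r%:R^-1) * (1 + 2 / r%:R).
pose ga : R := (m * ((2 * r + 1) * (r + 2)))%:R.
(* In the total cost, [A] is the coefficient of [k] and [B] the constant term. The 2 in [B] stands
   for two errors that are at most 1 for large [n]. *)
pose A : R := (2 * al * ga + al) / 4 + sg%:R * m%:R * r.+1%:R ^+ 2.
pose B : R := (ga ^+ 2 + ga) / 4 + 2.
have al0 : 0 <= al by rewrite mulr_ge0 ?addr_ge0 ?divr_ge0 ?invr_ge0.
have ga0 : 0 <= ga by [].
have A0 : 0 <= A.
  by rewrite addr_ge0 ?divr_ge0 ?addr_ge0 ?mulr_ge0 ?exprn_ge0.
have B0 : 0 <= B by rewrite addr_ge0 ?divr_ge0 ?addr_ge0 ?exprn_ge0.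
have [k0 k0P] : exists k0 : nat, r%:R * (A + B) <= k0%:R.
  exists (Num.bound (r%:R * (A + B))); apply/ltW/archi_boundP.
  exact: mulr_ge0 (ler0n _ _) (addr_ge0 A0 B0).
exists k0.+1 => k kk0; have k1 : (0 < k)%N by apply: leq_trans kk0.
have kr : 0 < k%:R :> R by rewrite ltr0n.
have kAB : r%:R * (A + B) <= k%:R.
  by apply: le_trans k0P _; rewrite ler_nat ltnW.
pose t := (k * sg)%N; pose s := (k * r)%N.
(* [K] bounds the number of trees per block and is a multiple of [r ^ 2] so that [c] is an integer.
   This [c] makes a vertex send about [K * (r + 2) / r] light edges into a block, where
   [K * (r + 1) / r] are needed; the surplus absorbs the rounding of the block size. *)
pose h := (k %/ (m * r ^ 2)).+1; pose K := (r ^ 2 * h)%N.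
pose c := (m * h * ((2 * r + 1) * (r + 2)))%N.
(* The contribution of disconnected reserves is exactly [D / n]; being below 1, it also gives the
   connectivity hypothesis. *)
have [D DE] : exists D : nat, D%:R = k%:R ^+ 2 * (16 * (k + s * 2)%:R ^+ 2) ^+ 4 :> R.
  by exists (k ^ 2 * (16 * (k + s * 2) ^ 2) ^ 4)%N; rewrite !(natrM, natrX).
exists (8 + c + m * r.+2 + t * k + D).+1 => n d T P X nn0 uX iX.
have [n8' /ltnW cn mn' tkn' Dn'] := sum_lt _ _ _ _ _ _ nn0; have n8 := ltnW n8'.
have n2 : (2 <= n)%N := leq_trans (isT : (2 <= 8)%N) n8.
have n1 : (0 < n)%N := ltnW n2.
have nr : 0 < n%:R :> R by rewrite ltr0n.
have tkn : (t * k)%:R <= n%:R :> R by rewrite ler_nat ltnW.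
have Dn : D%:R < n%:R :> R by rewrite ltr_nat.
have mn : (m * r.+2)%:R <= n%:R :> R by rewrite ler_nat ltnW.
have t0 : (0 < t)%N by rewrite muln_gt0 k1.
have K0 : (0 < K)%N by rewrite muln_gt0 expn_gt0 r0.
have mr2 : (0 < m * r ^ 2)%N by rewrite muln_gt0 m0 expn_gt0 r0.
have kmK : (k <= m * K)%N by rewrite /K mulnA mulnC /h ltnW // ltn_ceil.
have kK : (k %/ m <= K)%N by rewrite -(mulKn K m0) leq_div2r.
have hle : (h * (m * r ^ 2) <= k + m * r ^ 2)%N.
  by rewrite /h mulSn addnC leq_add2r leq_trunc_div.
(* The least [J] with [n <= t * 2 ^ J]: all levels are covered, and by minimality every earlier
   threshold is at most [n]. *)
have [J tJn tjn] : exists2 J, (n <= t * 2 ^ J)%N & forall j, (j < J)%N -> (t * 2 ^ j <= n)%N.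
  have ex : exists J, (n <= t * 2 ^ J)%N.
    by exists n; rewrite (leq_trans (ltnW (ltn_expl n (leqnn 2)))) // leq_pmull.
  have [J nJ Jmin] := ex_minnP ex; exists J => // j jJ.
  by rewrite ltnW // ltnNge; apply/negP => /Jmin; rewrite leqNgt jJ.
have WE : (k + s * 2)%:R = k%:R * (1 + 2 * r%:R) :> R.
  by rewrite /s !(natrM, natrD); ring.
have W0 : 0 < (k + s * 2)%:R :> R by rewrite ltr0n addn_gt0 k1.
have starved_bound : K%:R * r.+1%:R <=
    (n%:R / m%:R - 1) * ((c * s)%:R / (n%:R * (k + s * 2)%:R)) * r%:R :> R.
  have q0 : 0 < 1 + 2 * r%:R :> R by rewrite ltr_pwDl // mulr_ge0.
  have -> : (n%:R / m%:R - 1) * ((c * s)%:R / (n%:R * (k + s * 2)%:R)) * r%:R =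
     K%:R * (r%:R + 2 - (m%:R * (r%:R + 2)) / n%:R) :> R.
    rewrite WE /c /s /K !(natrM, natrD, natrX); field.
    by rewrite !gt_eqF.
  rewrite ler_wpM2l // -natr1.
  have : m%:R * (r%:R + 2) / n%:R <= 1 :> R.
    by rewrite ler_pdivrMr // mul1r -natrD -natrM addn2.
  lra.
have dis : k%:R ^+ 2 * n%:R ^+ 3 * (16 * (k + s * 2)%:R ^+ 2 / n%:R) ^+ 4 = D%:R / n%:R :> R.
  rewrite DE; move: (k + s * 2)%:R => w; field.
  by rewrite gt_eqF.
have conn : k%:R * (n%:R * (16 * (k + s * 2)%:R ^+ 2 / n%:R) ^+ 4) < 1 :> R.
  have e0 : 0 <= (16 * (k + s * 2)%:R ^+ 2 / n%:R) ^+ 4 :> R.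
    by rewrite exprn_ge0 // divr_ge0 // mulr_ge0 // exprn_ge0.
  apply: (@le_lt_trans _ _ (D%:R / n%:R)); last by rewrite ltr_pdivrMr // mul1r.
  rewrite -dis mulrA ler_wpM2r // ler_pM //.
    by rewrite -natrX ler_nat -{1}(expn1 k) leq_pexp2l.
  by rewrite -natrX ler_nat -{1}(expn1 n) leq_pexp2l.
apply: le_trans (mst_le n2 k1 uX iX m0 cn t0 n8 K0 r0 kK tJn tjn starved_bound conn) _.
rewrite lee_fin dis.
have cle : c%:R <= al * k%:R + ga.
  have -> : al * k%:R + ga = (k + m * r ^ 2)%:R * (((2 * r + 1) * (r + 2))%:R / r%:R ^+ 2).
    rewrite /al /ga !(natrM, natrD, natrX); field; by rewrite gt_eqF.
  have -> : c%:R = (h * (m * r ^ 2))%:R * (((2 * r + 1) * (r + 2))%:R / r%:R ^+ 2) :> R.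
    rewrite /c !(natrM, natrD, natrX); field; by rewrite gt_eqF.
  by rewrite ler_wpM2r ?ler_nat // divr_ge0 // exprn_ge0.
have cost1 : (c * c.+1)%:R / 4 <= ((al * k%:R + ga) ^+ 2 + (al * k%:R + ga)) / 4.
  rewrite ler_wpM2r ?invr_ge0 // natrM -natr1 mulrDr mulr1 lerD // expr2 ler_pM //.
have cost2 : k%:R * (t%:R * (m%:R^-1 + n%:R^-1 + r.+1%:R ^+ 2 / K%:R) +
     1088 * (k + s * 2)%:R ^+ 2 / t%:R) <=
   2 * (k%:R ^+ 2 / r%:R) + 1 + sg%:R * m%:R * r.+1%:R ^+ 2 * k%:R :> R.
  apply: (@le_trans _ _ (2 * (k%:R ^+ 2 / r%:R) + (t * k)%:R / n%:R
     + sg%:R * r.+1%:R ^+ 2 * k%:R * (k%:R / K%:R))).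
    have W1 : 1088 * (k%:R * (1 + 2 * r%:R)) ^+ 2 = k%:R ^+ 2 * (sg%:R / r%:R) :> R.
      by rewrite sgE; field; rewrite gt_eqF.
    have Kr : 0 < K%:R :> R by rewrite ltr0n.
    rewrite WE W1 /t /m !natrM le_eqVlt; apply/orP; left; apply/eqP.
    move: K%:R Kr r.+1%:R => K' Kr r'; field; by rewrite !gt_eqF.
  apply: lerD; first by rewrite lerD2l ler_pdivrMr // mul1r.
  have -> : sg%:R * m%:R * r.+1%:R ^+ 2 * k%:R =
    sg%:R * r.+1%:R ^+ 2 * k%:R * m%:R :> R by ring.
  rewrite ler_wpM2l ?mulr_ge0 ?exprn_ge0 //.
  by rewrite ler_pdivrMr ?ltr0n // -natrM ler_nat.
have cost3 : D%:R / n%:R <= 1 :> R by rewrite ler_pdivrMr // mul1r ltW.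
have small : A * k%:R + B <= k%:R ^+ 2 / r%:R.
  have k1r : 1 <= k%:R :> R by rewrite ler1n.
  apply: (@le_trans _ _ ((A + B) * k%:R)).
    by rewrite [leRHS](mulrDl A B) lerD2l ler_peMr.
  rewrite ler_pdivlMr // expr2 mulrAC [(A + B) * _]mulrC.
  by rewrite ler_wpM2r // ltW.
(* With [y = 1 / r] the left side is [(1 + 5 / 2 * y + y ^ 2) ^ 2], and [y ^ j <= y] for the higher
   powers. The 20 found here and the three errors [k ^ 2 / r] make up the constant 23. *)
have alle : al ^+ 2 / 4 <= 1 + 20 / r%:R.
  pose y : R := r%:R^-1; have y0 : 0 <= y by rewrite invr_ge0.
  have y1 : y <= 1 by rewrite invf_le1.
  rewrite /al -/y; nra.
have : k%:R ^+ 2 * (al ^+ 2 / 4) <= k%:R ^+ 2 * (1 + 20 / r%:R).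
  by rewrite ler_wpM2l ?exprn_ge0.
move: cost1 cost2 cost3 small; rewrite /A /B.
have -> : k%:R ^+ 2 * (1 + 23 / r%:R) =
  k%:R ^+ 2 * (1 + 20 / r%:R) + 3 * (k%:R ^+ 2 / r%:R) :> R by ring.
move: ((c * c.+1)%:R : R) (D%:R / n%:R : R) => x1 x2.
set x3 := k%:R * (_ + 1088 * _ / _).
move: x3 (k%:R ^+ 2 * (1 + 20 / r%:R) : R) (k%:R ^+ 2 / r%:R : R) => x3 x4 x5.
move: (al) (ga) (k%:R : R) (sg%:R : R) (m%:R : R) (r.+1%:R : R).
move=> al' ga' k' sg' m' r' H1 H2 H3 H4 H5; lra.
Qed.

End Asymptotics.

(** * Passage to the limits in [n] and in [k] *)

Section LimInfSup.
Variables (R : realType) (u : (\bar R)^nat).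

Lemma limn_esup_le (N : nat) (a : \bar R) :
  (forall n, (N <= n)%N -> (u n <= a)%E) -> (limn_esup u <= a)%E.
Proof.
move=> ua; rewrite limn_esup_lim; apply: lime_le; first exact: is_cvg_esups.
exists N => // n Nn; apply: ub_ereal_sup => _ [p np <-].
by apply: ua; apply: leq_trans np.
Qed.

Lemma limn_einf_ge (N : nat) (a : \bar R) :
  (forall n, (N <= n)%N -> (a <= u n)%E) -> (a <= limn_einf u)%E.
Proof.
move=> ua; rewrite limn_einf_lim; apply: lime_ge; first exact: is_cvg_einfs.
exists N => // n Nn; apply: le_ereal_inf_tmp => _ [p np <-].
by apply: ua; apply: leq_trans np.
Qed.

End LimInfSup.

Lemma squeeze_ratio_cvg1 (R : realType) (mu : (\bar R)^nat) :
  (forall r : nat, (0 < r)%N -> \forall k \near \oo,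
    ((k%:R ^+ 2 * (1 - 23 / r%:R))%:E <= mu k <= (k%:R ^+ 2 * (1 + 23 / r%:R))%:E)%E) ->
  (fun k => mu k * ((k%:R ^+ 2)^-1)%:E)%E @ \oo --> 1%:E.
Proof.
move=> bounds.
have ratio (r : nat) : (0 < r)%N -> \forall k \near \oo,
    exists2 y : R, (mu k * ((k%:R ^+ 2)^-1)%:E = y%:E)%E & `|1 - y| <= 23 / r%:R.
  move=> r0; near=> k.
  have k0 : (0 < k)%N by near: k; exists 1%N.
  have kr : 0 < k%:R ^+ 2 :> R by rewrite exprn_gt0 // ltr0n.
  have : ((k%:R ^+ 2 * (1 - 23 / r%:R))%:E <= mu k <= (k%:R ^+ 2 * (1 + 23 / r%:R))%:E)%E.
    by near: k; apply: bounds.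
  case: (mu k) => [y| |] /andP[] //; rewrite !lee_fin => ly yu.
  exists (y / k%:R ^+ 2); first by rewrite EFinM.
  rewrite distrC ler_norml lerBrDr lerBlDr ler_pdivlMr // ler_pdivrMr //.
  by apply/andP; split; lra.
apply/fine_cvgP; split.
  (* Any fixed accuracy, here [r = 1], shows that the ratio is eventually finite. *)
  have := ratio 1%N isT; apply: filterS => k [y -> _]; by [].
apply/cvgrPdist_le => e e0.
have [r r0 re] : exists2 r : nat, (0 < r)%N & 23 / r%:R <= e.
  exists (Num.bound (23 / e)).+1 => //.
  rewrite ler_pdivrMr ?ltr0n // mulrC -ler_pdivrMr //.
  apply: le_trans (ltW (archi_boundP (divr_ge0 (ler0n R 23) (ltW e0)))) _.
  by rewrite ler_nat.
apply: filterS (ratio r r0) => k [y /= -> ye]; exact: le_trans re.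
Unshelve. all: by end_near.
Qed.

Theorem theorem1 (R : realType) (d : nat -> measure_display)
    (T : forall n : nat, measurableType (d n))
    (P : forall n : nat, probability (T n) R)
    (X : forall n : nat, edge n -> {RV (P n) >-> R})
    (X_uniform : forall n : nat, (2 <= n)%N -> forall e : edge n,
       uniform01 (X n e))
    (X_indep : forall n : nat, (2 <= n)%N -> mutually_independent (X n)) :
  let mu_inf (k : nat) : \bar R := limn_einf (fun n => mst k (X n)) in
  let mu_sup (k : nat) : \bar R := limn_esup (fun n => mst k (X n)) in
  ((fun k : nat => mu_inf k * ((k%:R ^+ 2)^-1)%:E)%E @ \oo --> 1%:E) /\
  ((fun k : nat => mu_sup k * ((k%:R ^+ 2)^-1)%:E)%E @ \oo --> 1%:E).
Proof.
move=> mu_inf mu_sup.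
have inf_sup k : (mu_inf k <= mu_sup k)%E := limn_einf_sup _.
have upper (r : nat) : (0 < r)%N -> \forall k \near \oo,
    (mu_sup k <= (k%:R ^+ 2 * (1 + 23 / r%:R))%:E)%E.
  move=> r0; have [k0 bound] := mst_eventually_le R r0.
  exists k0 => // k /bound [n0 mst_n0]; apply: (@limn_esup_le _ _ (n0 + 2)) => n n0n.
  have n2 : (2 <= n)%N by apply: leq_trans n0n; rewrite leq_addl.
  apply: mst_n0; [by apply: leq_trans n0n; rewrite leq_addr|exact: X_uniform|exact: X_indep].
have lower (r : nat) : (0 < r)%N -> \forall k \near \oo,
    ((k%:R ^+ 2 * (1 - 23 / r%:R))%:E <= mu_inf k)%E.
  move=> r0; exists r.+1 => // k rk.
  have rr : 0 < r%:R :> R by rewrite ltr0n.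
  have k0 : (0 < k)%N by apply: leq_trans rk.
  have kr : 0 < k%:R :> R by rewrite ltr0n.
  apply: (@limn_einf_ge _ _ (k + 2)) => n kn.
  have n2 : (2 <= n)%N by apply: leq_trans kn; rewrite leq_addl.
  have nr : 0 < n%:R :> R by rewrite ltr0n ltnW.
  apply: le_trans (mst_ge n2 k0 (X_uniform n n2) (X_indep n n2)); rewrite lee_fin.
  (* For [n >= k] the factor [n.-1 / n] costs at most a further [k]; the total loss [3 / 2 * k] is
     below [23 * k ^ 2 / r] because [k > r]. *)
  apply: (@le_trans _ _ (k%:R ^+ 2 - 3 / 2 * k%:R)).
    rewrite mulrBr mulr1 lerD2l lerN2 mulrA ler_pdivlMr //.
    have : r%:R <= k%:R :> R by rewrite ler_nat ltnW.
    move: (r%:R : R) (k%:R : R) kr => x y y0 xy; nra.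
  have -> : n.-1%:R = n%:R - 1 :> R by rewrite -subn1 natrB // ltnW.
  rewrite mulrBl divff ?gt_eqF // div1r mulrBl mul1r.
  have : n%:R^-1 * k%:R <= 1 :> R.
    by rewrite mulrC ler_pdivrMr // mul1r ler_nat (leq_trans _ kn) // leq_addr.
  have : 0 <= n%:R^-1 :> R by rewrite invr_ge0.
  move: (n%:R^-1 : R) (k%:R : R) kr => x y y0 x0 xy; nra.
split; apply: squeeze_ratio_cvg1 => r r0; near=> k; apply/andP; split.
- by near: k; apply: lower.
- by apply: le_trans (inf_sup k) _; near: k; apply: upper.
- by apply: le_trans (inf_sup k); near: k; apply: lower.
- by near: k; apply: upper.
Unshelve. all: by end_near.
Qed.
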